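(* Let $\bar c$, $H'$, $P$, $\Delta$ be as described below. Suppose $\bar\xi,\bar\xi'$ are adjacent vertices of $\Delta$ (joined by an edge of $\Delta$), both of type (1B), such that the lines from $\bar c$ through $\bar\xi,\bar\xi'$ meet $\operatorname{conv}(\frac12(d+\mathcal W))$ in the points $\bar u,\bar w$ respectively, where $u,w\in\mathcal W$, with $\bar u=\frac12(\bar a+\bar c)$, $\bar w=\frac12(\bar a'+\bar c)$ for null $\bar a,\bar a'\in\mathcal C$. Suppose $P^{-1}(\bar\xi\bar\xi')$ is a 2-dimensional face of $\operatorname{conv}(\frac12(d+\mathcal W))$ whose corresponding face of $\operatorname{conv}(\mathcal W)$ is a parallelogram, and that the four vertices of this parallelogram are the only elements of $\mathcal W$ in the face. Let $E$ be the affine 2-plane spanned by $P^{-1}(\bar\xi\bar\xi')$. Then $u$ and $w$ are adjacent vertices of the parallelogram; letting $v$ be the vertex adjacent to $u$ other than $w$, and $s$ the vertex adjacent to $w$ other than $u$, either (i) $\mathcal C\cap E=\{\bar c,\bar a,\bar a',\bar e\}$ where $\bar e$ is null, $\bar v=\frac12(\bar a+\bar e)$ and $\bar s=\frac12(\bar a'+\bar e)$; or (ii) $\bar v,\bar s\in\mathcal C$ and $J(\bar a,\bar v)=J(\bar a',\bar s)=J(\bar s,\bar v)=0$. Moreover, if none of $v,u,s,w$ is of type I, then (i) cannot occur.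
   Context: Setting: $G$ compact Lie group, $K\subset G$ closed, $G/K$ connected almost effective, isotropy representation $\mathfrak p=\mathfrak p_1\oplus\cdots\oplus\mathfrak p_r$ ($r\ge2$) with pairwise inequivalent $\mathbb R$-irreducible summands, $d_i=\dim\mathfrak p_i$, $d=(d_1,\dots,d_r)$, $n=\sum d_i$. The scalar curvature of the metric $e^{q_i}Q$ on $\mathfrak p_i$ is $S(q)=\sum_{w\in\mathcal W}A_we^{w\cdot q}$, $\mathcal W\subset\mathbb Z^r$ finite, $A_w\ne0$, each $w$ of type I (one entry $-1$), type II (one entry $1$, two entries $-1$) or type III (one entry $1$, one entry $-2$), other entries $0$; $A_w>0$ for type I and $<0$ otherwise. Assume $\dim\operatorname{conv}(\mathcal W)=r-1$. $J$ is the symmetric bilinear form with $J(p,p)=\frac1{n-1}(\sum p_i)^2-\sum p_i^2/d_i$; null means $J(\bar x,\bar x)=0$. $u=\sum_{\bar c\in\mathcal C}F_{\bar c}e^{\bar c\cdot q}$ ($\mathcal C$ finite, $F_{\bar c}\ne0$) is a superpotential: for every $\xi$, $\sum_{(\bar a,\bar c)\in\mathcal C^2,\ \bar a+\bar c=\xi}J(\bar a,\bar c)F_{\bar a}F_{\bar c}$ equals $A_w$ if $\xi=d+w$, $w\in\mathcal W$, and $0$ otherwise; $\mathcal C$ lies in $\mathcal H=\{\sum\bar x_i=\frac12(n-1)\}$. For $x$ with $\sum x_i=-1$ write $\bar x=\frac12(d+x)$. $\bar c$ is a null vertex of $\operatorname{conv}(\mathcal C)$ (it lies outside $\operatorname{conv}(\frac12(d+\mathcal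 W))$); $H'\subset\mathcal H$ is an affine hyperplane strictly separating $\bar c$ from $\operatorname{conv}(\frac12(d+\mathcal W))$; $P$ sends $\bar z$ to the intersection of the ray from $\bar c$ through $\bar z$ with $H'$; $\Delta$ is the image of $P$. A vertex $\bar\xi$ of $\Delta$ is of type (1B) if the line through $\bar c,\bar\xi$ meets $\operatorname{conv}(\frac12(d+\mathcal W))$ in a unique point $\bar x$ and there is a null $\bar a\in\mathcal C$ with $\frac12(\bar a+\bar c)=\bar x$. *)

(* Defs.v *)
From HB Require Import structures.
From mathcomp Require Import all_boot all_order all_algebra.
From mathcomp Require Import reals.

Set Implicit Arguments.
Unset Strict Implicit.
Unset Printing Implicit Defensive.

Import Order.TTheory GRing.Theory Num.Theory.
Local Open Scope ring_scope.

Section Convexity.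
Variable R : realType.
Variable r : nat.
Local Notation V := 'rV[R]_r.

Definition dotv (x y : V) : R := \sum_(i < r) x 0 i * y 0 i.
Definition sumv (x : V) : R := \sum_(i < r) x 0 i.

Definition conv_seq (S : seq V) (x : V) : Prop :=
  exists lam : 'I_(size S) -> R,
    (forall i, 0 <= lam i) /\ \sum_i lam i = 1 /\
    x = \sum_i lam i *: S`_(nat_of_ord i).

Definition segment (x y z : V) : Prop :=
  exists t : R, 0 <= t <= 1 /\ z = (1 - t) *: x + t *: y.

Definition is_extreme (K : V -> Prop) (x : V) : Prop :=
  K x /\ forall y z (t : R), K y -> K z -> 0 < t < 1 ->
    x = (1 - t) *: y + t *: z -> y = x /\ z = x.

Definition convex_set (K : V -> Prop) : Prop :=
  forall y z (t : R), K y -> K z -> 0 <= t <= 1 -> K ((1 - t) *: y + t *: z).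

Definition is_face (K Fc : V -> Prop) : Prop :=
  (forall x, Fc x -> K x) /\ convex_set Fc /\ (exists x, Fc x) /\
  forall y z (t : R), K y -> K z -> 0 < t < 1 ->
    Fc ((1 - t) *: y + t *: z) -> Fc y /\ Fc z.

Definition adjacent_vertices (K : V -> Prop) (x x' : V) : Prop :=
  is_extreme K x /\ is_extreme K x' /\ x != x' /\ is_face K (segment x x').

Definition aff_hull (K : V -> Prop) (x : V) : Prop :=
  exists (k : nat) (p : 'I_k.+1 -> V) (mu : 'I_k.+1 -> R),
    (forall i, K (p i)) /\ \sum_i mu i = 1 /\ x = \sum_i mu i *: p i.

Definition affdim_eq (K : V -> Prop) (k : nat) : Prop :=
  exists p : 'I_k.+1 -> V, (forall i, K (p i)) /\
    let M := \matrix_(i < k) (p (lift ord0 i) - p ord0) in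
    row_free M /\ forall q, K q -> (q - p ord0 <= M)%MS.

Definition on_line (x y z : V) : Prop := exists t : R, z = x + t *: (y - x).

(* central projection from c onto H' = {x | dotv lam x = beta} *)
Definition proj (c lam : V) (beta : R) (z : V) : V :=
  c + ((beta - dotv lam c) / (dotv lam z - dotv lam c)) *: (z - c).

End Convexity.

Section Superpotential.
Variable R : realType.
Variable r : nat.
Local Notation V := 'rV[R]_r.
Variable d : 'I_r -> nat.

Definition nd : nat := \sum_(i < r) d i.
Definition dR : V := \row_i (d i)%:R.
Definition intvR (w : 'rV[int]_r) : V := map_mx (fun z : int => z%:~R) w.

Definition Jf (p q : V) : R :=
  (nd%:R - 1)^-1 * (sumv p * sumv q) - \sum_(i < r) p 0 i * q 0 i / (d i)%:R.
Definition null (x : V) : Prop := Jf x x = 0.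

Definition barW (w : 'rV[int]_r) : V := 2^-1 *: (dR + intvR w).

Definition inH (x : V) : Prop := sumv x = 2^-1 * (nd%:R - 1).

Definition Wpoly (W : seq 'rV[int]_r) : V -> Prop := conv_seq (map barW W).

(* coefficient of e^{xi.q} in J(u,u) for u = sum F_c e^{c.q} *)
Definition sp_coef (C : seq V) (F : V -> R) (xi : V) : R :=
  \sum_(p <- C) \sum_(q <- C | p + q == xi) Jf p q * F p * F q.

Definition superpotential (W : seq 'rV[int]_r) (A : 'rV[int]_r -> R)
    (C : seq V) (F : V -> R) : Prop :=
  (forall w, w \in W -> sp_coef C F (dR + intvR w) = A w) /\
  (forall xi, (forall w, w \in W -> xi != dR + intvR w) -> sp_coef C F xi = 0).

End Superpotential.

Section Types.
Variable r : nat.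
Definition typeI (w : 'rV[int]_r) : Prop :=
  exists i, w 0 i = -1 /\ forall l, l != i -> w 0 l = 0.
Definition typeII (w : 'rV[int]_r) : Prop :=
  exists i j k, [/\ i != j, i != k & j != k] /\
    w 0 i = 1 /\ w 0 j = -1 /\ w 0 k = -1 /\
    forall l, l != i -> l != j -> l != k -> w 0 l = 0.
Definition typeIII (w : 'rV[int]_r) : Prop :=
  exists i j, i != j /\ w 0 i = 1 /\ w 0 j = -2 /\
    forall l, l != i -> l != j -> w 0 l = 0.
End Types.

Arguments intvR {R r} w.
Arguments dR {R r} d.
Arguments barW {R r} d w.

(* Main.v *)
(** Every element of [C] lies in the cone with apex [c] over [conv((d+W)/2)].  Otherwise
    some face of [conv(C)] through [c] leaves this cone; all sums of its elements
    other than [2 c] avoid [d + W], which forces [J >= 0] on it, and then the sum of [c]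
    and the next element of the face cannot be cancelled.  Since [E] cuts
    [conv((d+W)/2)] in a face, two elements of [C] whose sum lies in [2 E] both lie in
    [E], and the superpotential equations restrict to the plane [E].

    In [E] take the affine coordinates with [c = (0,0)], [a = (1,0)], [a' = (0,1)].
    There [J(c,p) > 0] for every [p <> c] in [C], so [c + p] is always in [d + W] or is
    the sum of two other elements; hence [C] lies in the monoid generated by [a], [a'],
    [2 v] and [2 s].  Following the edges of the convex hull of [C] in [E] from [a] and
    from [a'], the next element is either [e = 2 v - a = 2 s - a'], or [v], resp. [s].
    The latter alternatives cannot hold simultaneously by integrality in the monoid,
    and [e] excludes them, so [e] is in [C] and [C] meets [E] in [c, a, a', e] only.
    Thus (i) always holds.  If no vertex is of type I, then the equations at [u] and [s]
    give [F_c F_a < 0] and [F_a' F_e < 0], which makes the coefficient at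
    [a + a'] nonzero: a contradiction. *)

Require Import Defs.
From HB Require Import structures.
From mathcomp Require Import all_boot all_order all_algebra.
From mathcomp Require Import reals boolp ring lra.
Import Order.TTheory GRing.Theory Num.Theory.
Local Open Scope ring_scope.
Set Implicit Arguments.
Unset Strict Implicit.
Unset Printing Implicit Defensive.

(** * Minima and maxima over finite sequences *)

Lemma seq_argmin (R : realDomainType) (T : eqType) (f : T -> R) (s : seq T) x0 :
  x0 \in s -> exists2 x, x \in s & forall y, y \in s -> f x <= f y.
Proof.
elim: s x0 => // z s IH x0 _; case: s IH => [_|z' s IH].
  by exists z => [|y]; rewrite ?inE // => /eqP ->.
have [|x xs xmin] := IH z'; first by rewrite inE eqxx.
have [zx|xz] := lerP (f z) (f x).
  exists z => [|y]; rewrite inE ?eqxx // => /predU1P[-> //|/xmin].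
  exact: le_trans.
exists x => [|y]; first by rewrite inE xs orbT.
by rewrite inE => /predU1P[->|/xmin //]; exact: ltW.
Qed.

Lemma seq_argmax (R : realDomainType) (T : eqType) (f : T -> R) (s : seq T) x0 :
  x0 \in s -> exists2 x, x \in s & forall y, y \in s -> f y <= f x.
Proof.
move=> /(seq_argmin (fun x => - f x))[x xs xmax]; exists x => // y /xmax.
by rewrite lerN2.
Qed.

(** * Planar configurations *)

Section Planar.
Variable R : realFieldType.
Implicit Types (p q t : R * R) (D : seq (R * R)).

Lemma pair_ext p q : p.1 = q.1 -> p.2 = q.2 -> p = q.
Proof. by case: p q => [? ?] [? ?] /= -> ->. Qed.

(* [J] on the plane through null [c], [a], [b], in the affine coordinates where these are
   [(0,0)], [(1,0)], [(0,1)], with [al = J(c,a)], [be = J(c,b)], [ga = J(a,b)]. *)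
Definition barycentric_form (al be ga : R) p q :=
  al * ((1 - p.1 - p.2) * q.1 + p.1 * (1 - q.1 - q.2))
  + be * ((1 - p.1 - p.2) * q.2 + p.2 * (1 - q.1 - q.2))
  + ga * (p.1 * q.2 + p.2 * q.1).

(* [D] stands for [C] in the plane; the sums [(1,0)], [(0,1)], [V], [S] are the
   coordinate vectors of [2 u], [2 w], [2 v], [2 s], the only elements of [d + W] there. *)
Record planar_config al be ga D (F : R * R -> R) (V S : R * R) : Prop := {
  pl_al : 0 < al;
  pl_be : 0 < be;
  pl_ga : 0 < ga;
  pl_neg p q : p <> q ->
    barycentric_form al be ga p p + barycentric_form al be ga q q
    < 2 * barycentric_form al be ga p q;
  pl_c : (0, 0) \in D;
  pl_a : (1, 0) \in D;
  pl_b : (0, 1) \in D;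
  pl_ge0 p : p \in D -> 0 <= p.1 /\ 0 <= p.2;
  pl_V : 0 < V.1 /\ 0 < V.2;
  pl_S : 0 < S.1 /\ 0 < S.2;
  pl_sumV : exists p q, [/\ p \in D, q \in D & p + q = V];
  pl_sumS : exists p q, [/\ p \in D, q \in D & p + q = S];
  pl_bal p q : p \in D -> q \in D -> barycentric_form al be ga p q != 0 ->
    p + q \in [:: (1, 0); (0, 1); V; S] \/
    exists p' q', [/\ p' \in D, q' \in D, p' + q' = p + q &
      (barycentric_form al be ga p q * F p * F q) *
      (barycentric_form al be ga p' q' * F p' * F q') < 0]
}.

Definition swap p : R * R := (p.2, p.1).

Lemma swapK : involutive swap. Proof. by case. Qed.

Lemma mem_swap D p : (p \in map swap D) = (swap p \in D).
Proof. by rewrite -{1}[p]swapK mem_map //; exact: inv_inj swapK. Qed.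

Lemma barycentric_form_swap al be ga p q :
  barycentric_form be al ga (swap p) (swap q) = barycentric_form al be ga p q.
Proof. by rewrite /barycentric_form /=; ring. Qed.

(** The reflection exchanges [a] with [b] and [V] with [S], so what is proved about edges at [a]
    also applies at [b]. *)
Lemma planar_config_swap al be ga D F V S : planar_config al be ga D F V S ->
  planar_config be al ga (map swap D) (F \o swap) (swap S) (swap V).
Proof.
have sumP Z : (exists p q, [/\ p \in D, q \in D & p + q = Z]) ->
    exists p q, [/\ p \in map swap D, q \in map swap D & p + q = swap Z].
  move=> [p [q [pD qD <-]]]; exists (swap p), (swap q).
  by rewrite !mem_swap !swapK.
case=> al0 be0 ga0 neg cD aD bD ge0 [V1 V2] [S1 S2] sV sS bal.
split=> //; try exact: sumP; try by rewrite mem_swap.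
- move=> p q pq; rewrite -![barycentric_form be al ga _ _]barycentric_form_swap.
  by apply: neg => /(inv_inj swapK).
- by move=> p; rewrite mem_swap => /ge0[].
move=> p q; rewrite !mem_swap => pD qD.
rewrite -barycentric_form_swap => /bal -/(_ pD qD) [Hin|].
  left; have sD : swap p + swap q = swap (p + q) by [].
  move: Hin; rewrite sD !inE => /or4P[] /eqP /(congr1 swap);
  by rewrite swapK => ->; rewrite eqxx ?orbT.
move=> [p' [q' [p'D q'D E lt0]]]; right; exists (swap p'), (swap q').
rewrite !mem_swap !swapK; split=> //.
  by rewrite -[RHS]swapK -[swap (p + q)]E.
by rewrite [barycentric_form _ _ _ (swap p') _]barycentric_form_swap /= !swapK.
Qed.

(** * Edges and generators of a planar configuration *)

Section Config.
Variables (al be ga : R) (D : seq (R * R)) (F : R * R -> R) (V S : R * R).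
Hypothesis cfg : planar_config al be ga D F V S.
Local Notation J := (barycentric_form al be ga).

Lemma form_sym p q : J p q = J q p.
Proof. by rewrite /barycentric_form; ring. Qed.

(** A sum outside the four listed ones needs a second pair whose term has the opposite sign. If the
    decomposition is unique up to order, that pair is [p], [q] again and the product of the terms is
    a square. *)
Lemma unique_sum p q : p \in D -> q \in D -> J p q != 0 ->
  (forall p' q', p' \in D -> q' \in D -> p'.1 + q'.1 = p.1 + q.1 ->
     p'.2 + q'.2 = p.2 + q.2 -> (p' = p /\ q' = q) \/ (p' = q /\ q' = p)) ->
  [\/ p.1 + q.1 = 1 /\ p.2 + q.2 = 0, p.1 + q.1 = 0 /\ p.2 + q.2 = 1,
      p.1 + q.1 = V.1 /\ p.2 + q.2 = V.2 | p.1 + q.1 = S.1 /\ p.2 + q.2 = S.2].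
Proof.
move=> pD qD J0 un; have [|[p' [q' [p'D q'D E]]]] := pl_bal cfg pD qD J0.
  rewrite !inE => /or4P[] /eqP E; have := congr1 fst E; have := congr1 snd E => /=;
  by [constructor 1|constructor 2|constructor 3|constructor 4].
have E1 := congr1 fst E; have E2 := congr1 snd E.
have [[-> ->]|[-> ->]] := un p' q' p'D q'D E1 E2.
  by rewrite ltNge -expr2 sqr_ge0.
by rewrite form_sym [X in _ * X]mulrAC ltNge -expr2 sqr_ge0.
Qed.

(** Let [m] be the farthest element on the axis. If [m.1 > 1], then [J m m] is nonzero and [m + m]
    decomposes uniquely, but it is none of the four sums. *)
Lemma axis_le1 p : p \in D -> p.2 = 0 -> p.1 <= 1.
Proof.
move=> pD p2.
have [|m] := @seq_argmax _ _ (fun t => t.1) [seq t <- D | t.2 == 0] (1, 0).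
  by rewrite mem_filter /= eqxx (pl_a cfg).
rewrite mem_filter => /andP[/eqP m2 mD] mmax.
have m1 : 1 <= m.1 by apply: (mmax (1, 0)); rewrite mem_filter /= eqxx (pl_a cfg).
suff: m.1 <= 1 by apply: le_trans; apply: mmax; rewrite mem_filter p2 eqxx.
have [J0|J0] := eqVneq (J m m) 0.
  move: J0; rewrite /barycentric_form m2 => J0.
  have al0 := pl_al cfg.
  rewrite leNgt; apply/negP => m1'.
  have : 0 < al * ((m.1 - 1) * m.1) by rewrite !mulr_gt0 // ?subr_gt0 // (lt_le_trans ltr01).
  lra.
have [V1 V2] := pl_V cfg; have [S1 S2] := pl_S cfg.
have [] := unique_sum mD mD J0; try lra.
move=> p' q' p'D q'D; rewrite m2 => E1 E2; left.
have [p1 p2'] := pl_ge0 cfg p'D; have [q1 q2] := pl_ge0 cfg q'D.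
have pz : p'.2 = 0 by lra.
have qz : q'.2 = 0 by lra.
have := mmax p'; rewrite mem_filter pz eqxx p'D => /(_ isT) ?.
have := mmax q'; rewrite mem_filter qz eqxx q'D => /(_ isT) ?.
split; apply: pair_ext; lra.
Qed.

(** The determinant of [p - (1,0)] and [t - (1,0)]: it vanishes on the line through [(1,0)] and [p],
    and equals [p.2] at the origin. *)
Definition edge_fun p t := (p.1 - 1) * t.2 - p.2 * (t.1 - 1).

(** Rotate a ray about [(1,0)] away from the positive first axis. The first element met minimises
    [sl]; ties are broken towards [(1,0)], and elements on the axis are controlled by [axis_le1]. *)
Lemma edge_exists : exists p, [/\ p \in D, 0 < p.2,
  forall t, t \in D -> 0 <= edge_fun p t &
  forall t, t \in D -> 0 < t.2 -> edge_fun p t = 0 -> p.2 <= t.2].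
Proof.
pose sl t : R := (1 - t.1) / t.2.
have [|m] := @seq_argmin _ _ sl [seq t <- D | 0 < t.2] (0, 1).
  by rewrite mem_filter /= ltr01 (pl_b cfg).
rewrite mem_filter => /andP[m2 mD] mmin.
have [|p] := @seq_argmin _ _ (fun t => t.2) [seq t <- D | (0 < t.2) && (sl t == sl m)] m.
  by rewrite mem_filter m2 eqxx.
rewrite mem_filter => /andP[/andP[p2 /eqP psl] pD] pmin.
have slE t : 0 < t.2 -> edge_fun p t = p.2 * t.2 * (sl t - sl p).
  move=> t2; rewrite /edge_fun /sl; field; by rewrite !gt_eqF.
exists p; split=> // t tD => [|t2].
  have [t1 t2] := pl_ge0 cfg tD; have [t20|t20] := eqVneq t.2 0.
    have := axis_le1 tD t20; rewrite /edge_fun t20 mulr0 sub0r -mulrN => ?.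
    by rewrite mulr_ge0 ?(ltW p2) //; lra.
  have t2' : 0 < t.2 by rewrite lt_neqAle eq_sym t20.
  rewrite slE // mulr_ge0 ?mulr_ge0 ?subr_ge0 ?(ltW p2) // psl.
  by apply: mmin; rewrite mem_filter t2'.
rewrite slE // => /eqP; rewrite 2!mulf_eq0 (gt_eqF p2) (gt_eqF t2) /= subr_eq0 psl => slt.
by apply: pmin; rewrite mem_filter t2 slt.
Qed.

(** Let [p] be next to [(1,0)] on the edge. If [J (1,0) p] is nonzero, then [(1,0) + p] decomposes
    uniquely. Otherwise [p] is replaced by the far end [q] of the edge, where [J q q < 0] and
    [q + q] decomposes uniquely. *)
Lemma edge_alternative : exists p, [/\ p \in D, 0 < p.2,
  forall t, t \in D -> 0 <= edge_fun p t &
  ((1 + p.1 = V.1 /\ p.2 = V.2 \/ 1 + p.1 = S.1 /\ p.2 = S.2) /\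
    forall t, t \in D -> 0 < t.2 -> edge_fun p t = 0 -> p.2 <= t.2) \/
  [/\ p.1 + p.1 = V.1 /\ p.2 + p.2 = V.2 \/ p.1 + p.1 = S.1 /\ p.2 + p.2 = S.2,
    J (1, 0) p = 0 &
    forall t, t \in D -> edge_fun p t = 0 -> t.2 <= p.2]].
Proof.
have [p [pD p2 psup pmin]] := edge_exists.
have [V1 V2] := pl_V cfg; have [S1 S2] := pl_S cfg.
have p1 := (pl_ge0 cfg pD).1.
(* Nonnegative values with sum zero both vanish, so elements whose sum is that of two edge points
   lie on the edge. *)
have onl t t' : t \in D -> t' \in D -> edge_fun p t + edge_fun p t' = 0 ->
    edge_fun p t = 0 /\ edge_fun p t' = 0.
  by move=> /psup ? /psup ? ?; split; lra.
have [J0|J0] := eqVneq (J (1, 0) p) 0; last first.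
  exists p; split=> //; left; split=> //.
  have [|||E|E] := unique_sum (pl_a cfg) pD J0; try (by move: E; rewrite /= add0r; tauto);
    try (rewrite /=; lra).
  move=> p' q' p'D q'D /= E1 E2.
  have [|e1 e2] := onl p' q' p'D q'D.
    rewrite /edge_fun; have -> : q'.1 = 1 + p.1 - p'.1 by lra.
    have -> : q'.2 = p.2 - p'.2 by lra.
    by ring.
  have q'2 := (pl_ge0 cfg q'D).2; have p'2 := (pl_ge0 cfg p'D).2.
  have eq_a t : edge_fun p t = 0 -> t.2 = 0 -> t = (1, 0).
    rewrite /edge_fun => + t2; rewrite t2 => /eqP.
    rewrite mulr0 sub0r oppr_eq0 mulf_eq0 gt_eqF //= => /eqP ?.
    by apply: pair_ext => //=; lra.
  have [p0|p0] := eqVneq p'.2 0.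
    left; have Ep' := eq_a _ e1 p0; rewrite Ep' in E1 E2 *; split=> //.
    by apply: pair_ext; move: E1 E2 => /=; lra.
  have [q0|q0] := eqVneq q'.2 0.
    right; have Eq' := eq_a _ e2 q0; rewrite Eq' in E1 E2 *; split=> //.
    by apply: pair_ext; move: E1 E2 => /=; lra.
  have p'0 : 0 < p'.2 by rewrite lt_neqAle eq_sym p0.
  have q'0 : 0 < q'.2 by rewrite lt_neqAle eq_sym q0.
  have le1 := pmin p' p'D p'0 e1; have le2 := pmin q' q'D q'0 e2.
  by exfalso; move: E2 => /=; lra.
have [|q] := @seq_argmax _ _ (fun t => t.2) [seq t <- D | edge_fun p t == 0] p.
  by rewrite mem_filter pD andbT /edge_fun; apply/eqP; ring.
rewrite mem_filter => /andP[/eqP qon qD] qmax.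
have pq2 : p.2 <= q.2.
  by apply: qmax; rewrite mem_filter pD andbT /edge_fun; apply/eqP; ring.
have q2 : 0 < q.2 by exact: lt_le_trans pq2.
have linE t : p.2 * edge_fun q t = q.2 * edge_fun p t + (t.2 * edge_fun p q * - 1).
  by rewrite /edge_fun; ring.
have edge0 t : edge_fun q t = 0 -> edge_fun p t = 0.
  move=> e; have := linE t; rewrite e qon mulr0 mulr0 mul0r addr0 => /esym/eqP.
  by rewrite mulf_eq0 gt_eqF //= => /eqP.
(* [J (1,0)] is affine and vanishes at [(1,0)], hence is proportional to the second coordinate along
   the edge. *)
have Ja : p.2 * J (1, 0) q = q.2 * J (1, 0) p.
  by move: qon; rewrite /edge_fun /barycentric_form /= => qon; have ? := pl_al cfg; nra.
have Jq : J (1, 0) q = 0.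
  by move: Ja; rewrite J0 mulr0 => /eqP; rewrite mulf_eq0 gt_eqF //= => /eqP.
exists q; split=> //.
  move=> t tD; rewrite -(pmulr_rge0 _ p2) linE qon mulr0 mul0r addr0.
  by rewrite mulr_ge0 ?psup // ltW.
right; split=> //; last by move=> t tD /edge0 e; apply: qmax; rewrite mem_filter e eqxx.
(* [J] vanishes on the pairs [(1,0)], [(1,0)] and [(1,0)], [q], so [pl_neg] makes [J q q]
   negative. *)
have Jqq : J q q != 0.
  have := @pl_neg _ _ _ _ _ _ _ cfg (1, 0) q.
  rewrite Jq mulr0 => H; rewrite lt_eqF //.
  have -> : J q q = J (1, 0) (1, 0) + J q q by rewrite /barycentric_form /=; ring.
  by apply: H => E; rewrite -E ltxx in q2.
have [||[E1 E2]|E|E] := unique_sum qD qD Jqq; try tauto; try lra.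
move=> p' q' p'D q'D E1 E2.
have [|e1 e2] := onl p' q' p'D q'D.
  move: E1 E2 qon; rewrite /edge_fun => E1 E2 qon.
  have -> : q'.1 = q.1 + q.1 - p'.1 by lra.
  have -> : q'.2 = q.2 + q.2 - p'.2 by lra.
  by lra.
have := qmax p'; rewrite mem_filter e1 eqxx p'D => /(_ isT) ?.
have := qmax q'; rewrite mem_filter e2 eqxx q'D => /(_ isT) ?.
have eqq t : edge_fun p t = 0 -> t.2 = q.2 -> t = q.
  move=> e t2; apply: pair_ext => //; move: e qon; rewrite /edge_fun t2 => e qon.
  have : p.2 * (t.1 - q.1) = 0 by lra.
  by move/eqP; rewrite mulf_eq0 gt_eqF //= => /eqP; lra.
  by left; split; apply: eqq => //; lra.
(* What remains is [q + q = (0,1)]; there [J (1,0) q] is [(al + ga) / 2 > 0]. *)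
have := pl_al cfg; have := pl_ga cfg; move: Jq; rewrite /barycentric_form /=.
have -> : q.1 = 0 by lra.
have -> : q.2 = 2^-1 by lra.
lra.
Qed.

(** This is the case of opposite vertices [u], [w]. All coordinates of [V] and [S] are below 1, so
    neither is [(1,0) + p]; if one is [p + p], then [p.1 + p.2 < 1], which makes [J (1,0) p]
    positive. *)
Lemma opposite_absurd : V + S = (1, 1) -> False.
Proof.
move=> E; have := congr1 fst E; have := congr1 snd E => /= E2 E1.
have [V1 V2] := pl_V cfg; have [S1 S2] := pl_S cfg.
have [p [pD p2 _ [[] | []]]] := edge_alternative.
  by have := (pl_ge0 cfg pD).1; lra.
move=> H; rewrite /barycentric_form /= => J0 _.
have q0 : 0 < 1 - p.1 - p.2 by lra.
have := mulr_gt0 (pl_al cfg) q0; have := mulr_gt0 (pl_ga cfg) p2; lra.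
Qed.

(** For a counterexample [t] of least coordinate sum, [J (0,0) t > 0]. So [(0,0) + t] is one of the
    four generators or splits into two nonzero elements, each of smaller coordinate sum. *)
Lemma mem_monoid p : p \in D -> exists i j k l : nat,
  p = (i%:R + V.1 *+ k + S.1 *+ l, j%:R + V.2 *+ k + S.2 *+ l).
Proof.
pose good p := exists i j k l : nat,
  p = (i%:R + V.1 *+ k + S.1 *+ l, j%:R + V.2 *+ k + S.2 *+ l).
move=> pD; apply: contrapT => bad.
have [|t] := @seq_argmin _ _ (fun t => t.1 + t.2) [seq t <- D | ~~ `[< good t >]] p.
  by rewrite mem_filter pD andbT; apply/asboolPn.
rewrite mem_filter => /andP[/asboolPn tbad tD] tmin.
have [t1 t2] := pl_ge0 cfg tD.
have t0 : t <> (0, 0).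
  by move=> E; apply: tbad; rewrite E; exists 0, 0, 0, 0; rewrite !addr0.
have pos q : q \in D -> q <> (0, 0) -> 0 < q.1 + q.2.
  move=> qD q0; have [q1 q2] := pl_ge0 cfg qD.
  rewrite lt_neqAle addr_ge0 // andbT eq_sym paddr_eq0 //.
  by apply/negP => /andP[/eqP ? /eqP ?]; apply: q0; apply: pair_ext.
have J0 : J (0, 0) t != 0.
  rewrite gt_eqF // /barycentric_form /=.
  have h := pos t tD t0.
  have := mulr_ge0 (ltW (pl_al cfg)) t1; have := mulr_ge0 (ltW (pl_be cfg)) t2.
  have [t10|t10] := eqVneq t.1 0.
    have t20 : 0 < t.2 by lra.
    have := mulr_gt0 (pl_be cfg) t20; lra.
  have t10' : 0 < t.1 by rewrite lt_neqAle eq_sym t10.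
  have := mulr_gt0 (pl_al cfg) t10'; lra.
have [] := unique_sum (pl_c cfg) tD J0.
- move=> p' q' p'D q'D /= E1 E2; apply: contrapT => ne.
  apply: tbad.
  have p'0 : p' <> (0, 0).
    move=> E; apply: ne; left; split=> //; apply: pair_ext; move: E1 E2; rewrite E /=; lra.
  have q'0 : q' <> (0, 0).
    move=> E; apply: ne; right; split=> //; apply: pair_ext; move: E1 E2; rewrite E /=; lra.
  have hp := pos _ p'D p'0; have hq := pos _ q'D q'0.
  have goodP q : q \in D -> q.1 + q.2 < t.1 + t.2 -> good q.
    move=> qD; apply: contraPP => bq; apply/negP; rewrite -leNgt; apply: tmin.
    by rewrite mem_filter qD andbT; apply/asboolPn.
  have [||i [j [k [l Ep]]]] := goodP p' => //; first lra.
  have [||i' [j' [k' [l' Eq]]]] := goodP q' => //; first lra.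
  exists (i + i')%N, (j + j')%N, (k + k')%N, (l + l')%N.
  by apply: pair_ext; move: E1 E2; rewrite Ep Eq /= !natrD !mulrnDr; lra.
- move=> /= [E1 E2]; apply: tbad; exists 1, 0, 0, 0; apply: pair_ext; rewrite /= ?mulr0n; lra.
- move=> /= [E1 E2]; apply: tbad; exists 0, 1, 0, 0; apply: pair_ext; rewrite /= ?mulr0n; lra.
- move=> /= [E1 E2]; apply: tbad; exists 0, 0, 1, 0; apply: pair_ext; rewrite /= ?mulr0n; lra.
- move=> /= [E1 E2]; apply: tbad; exists 0, 0, 0, 1; apply: pair_ext; rewrite /= ?mulr0n; lra.
Qed.

End Config.

(** * Configurations with [u] and [w] adjacent *)

Section Adjacent.
Variables (al be ga : R) (D : seq (R * R)) (F : R * R -> R) (V S : R * R).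
Hypothesis cfg : planar_config al be ga D F V S.
Local Notation J := (barycentric_form al be ga).

Variables e1 e2 : R.
Hypotheses (e1_gt0 : 0 < e1) (e2_gt0 : 0 < e2).
Hypotheses (VE : V = (1 + e1, e2)) (SE : S = (e1, 1 + e2)).

(** The generators [V] and [S] have coordinate sum above 1, so in the monoid only the origin and the
    two unit vectors do not exceed 1. *)
Lemma sum_gt1 p : p \in D ->
  [\/ p = (0, 0), p = (1, 0), p = (0, 1) | 1 < p.1 + p.2].
Proof.
have e1p := e1_gt0; have e2p := e2_gt0.
case/(mem_monoid cfg)=> i [j [k [l ->]]]; rewrite VE SE /=.
case: k => [|k]; last first.
  have: 0 <= i%:R :> R by []; have: 0 <= j%:R :> R by [].
  have: 0 <= (1 + e1) *+ k by rewrite mulrn_wge0 //; lra.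
  have: 0 <= e2 *+ k by rewrite mulrn_wge0 //; lra.
  have: 0 <= (1 + e2) *+ l by rewrite mulrn_wge0 //; lra.
  have: 0 <= e1 *+ l by rewrite mulrn_wge0 //; lra.
  by rewrite !mulrS => *; constructor 4; lra.
case: l => [|l]; last first.
  have: 0 <= i%:R :> R by []; have: 0 <= j%:R :> R by [].
  have: 0 <= (1 + e2) *+ l by rewrite mulrn_wge0 //; lra.
  have: 0 <= e1 *+ l by rewrite mulrn_wge0 //; lra.
  by rewrite !mulrS !mulr0n => *; constructor 4; lra.
rewrite !mulr0n !addr0; case: i j => [|[|i]] [|[|j]];
  try (by [constructor 1|constructor 2|constructor 3]); constructor 4;
  by rewrite -natrD (ltr_nat R 1) ?addnS ?addSn.
Qed.

(** Neither [V] nor [S] can occur in a monoid expression of half of [V]: the former is too large,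
    the latter already in its second coordinate. Only unit vectors remain. *)
Lemma halfV_integral : (V.1 / 2, V.2 / 2) \in D ->
  exists i j : nat, (1 + e1) / 2 = i%:R :> R /\ e2 / 2 = j%:R :> R.
Proof.
have e1p := e1_gt0; have e2p := e2_gt0.
case/(mem_monoid cfg)=> i [j [k [l]]]; rewrite VE SE /= => -[E1 E2]; exists i, j.
have i0 : 0 <= i%:R :> R by []; have j0 : 0 <= j%:R :> R by [].
case: k E1 E2 => [|k].
  case: l => [|l]; first by rewrite !mulr0n !addr0.
  have: 0 <= (1 + e2) *+ l by rewrite mulrn_wge0 //; lra.
  have: 0 <= e1 *+ l by rewrite mulrn_wge0 //; lra.
  by rewrite !(mulrS _ l) !mulr0n => *; split; lra.
have: 0 <= (1 + e1) *+ k by rewrite mulrn_wge0 //; lra.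
have: 0 <= e2 *+ k by rewrite mulrn_wge0 //; lra.
have: 0 <= (1 + e2) *+ l by rewrite mulrn_wge0 //; lra.
have: 0 <= e1 *+ l by rewrite mulrn_wge0 //; lra.
by rewrite !(mulrS _ k) => *; split; lra.
Qed.

(** Outcomes of [edge_alternative] involving [S] would put [V] beyond the edge, although [V] is a
    sum of two elements of [D]. The others give [(e1, e2)] or its midpoint with [(1,0)], which is
    half of [V]. *)
Lemma adjacent_edge :
  [/\ (e1, e2) \in D, forall t, t \in D -> 0 <= edge_fun (e1, e2) t &
      (V.1 / 2, V.2 / 2) \notin D] \/
  ((V.1 / 2, V.2 / 2) \in D /\ (e1, e2) \notin D).
Proof.
have e1p := e1_gt0; have e2p := e2_gt0.
have [p [pD p2 psup H]] := edge_alternative cfg.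
(* The left sum of values of the affine [edge_fun p] at two elements with sum [V], the constant
   [p.2] being its value at the origin. *)
have Vin : 0 <= edge_fun p V + p.2.
  have [q [q' [qD q'D <-]]] := pl_sumV cfg.
  by have := psup _ qD; have := psup _ q'D; rewrite /edge_fun /=; lra.
have pgt : 1 < p.1 + p.2 \/ p = (0, 1).
  by case: (sum_gt1 pD) => [E|E|->|]; [rewrite E ltxx in p2|rewrite E ltxx in p2|right|left].
rewrite VE SE /= in H Vin *.
case: H => [[[] [E1 E2] pmin]|[[] [E1 E2] _ pmax]].
- left; have pE : p = (e1, e2) by apply: pair_ext => /=; lra.
  rewrite pE in psup pmin pD *; split=> //; apply/negP => /pmin /= H.
  have : e2 <= e2 / 2 by apply: H; [lra | rewrite /edge_fun /=; field].
  by lra.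
- exfalso; move: Vin; rewrite /edge_fun /=; have -> : p.1 = e1 - 1 by lra.
  rewrite E2; case: pgt => [|pE] ?; first lra.
  by move: E2; rewrite pE /=; lra.
- right; have pE : p = ((1 + e1) / 2, e2 / 2) by apply: pair_ext => /=; lra.
  rewrite pE in pD pmax; split=> //; apply/negP => /pmax /= H.
  have : e2 <= e2 / 2 by apply: H; rewrite /edge_fun /=; field.
  by lra.
- exfalso; move: Vin; rewrite /edge_fun /=.
  have -> : p.1 = e1 / 2 by lra.
  have -> : p.2 = (1 + e2) / 2 by lra.
  case: pgt => [|pE] ?; first lra.
  by move: E1; rewrite pE /=; lra.
Qed.

End Adjacent.

(** Both edges end at [(e1, e2)]. As the only maximiser of the coordinate sum it must be null, and
    its sum with the next largest element [m] could not be cancelled. *)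
Lemma adjacent_points al be ga D F V S e1 e2 :
  planar_config al be ga D F V S -> 0 < e1 -> 0 < e2 ->
  V = (1 + e1, e2) -> S = (e1, 1 + e2) ->
  [/\ (e1, e2) \in D, barycentric_form al be ga (e1, e2) (e1, e2) = 0, 1 < e1 + e2 &
      forall p, p \in D -> p \in [:: (0, 0); (1, 0); (0, 1); (e1, e2)]].
Proof.
set J := barycentric_form al be ga.
move=> cfg e1p e2p VE SE.
have cfg' := planar_config_swap cfg.
have VE' : swap S = (1 + e2, e1) by rewrite SE.
have SE' : swap V = (e2, 1 + e1) by rewrite VE.
have [eD sup sup'] : [/\ (e1, e2) \in D,
    forall t, t \in D -> 0 <= edge_fun (e1, e2) t &
    forall t, t \in D -> 0 <= edge_fun (e2, e1) (swap t)].
  have := adjacent_edge cfg' e2p e1p VE' SE'.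
  rewrite !mem_swap => -[[eD' sup' _]|[SD neD]]; last first.
    have [[eD]|[VD _]] := adjacent_edge cfg e1p e2p VE SE.
      by rewrite eD in neD.
    have [i [j [E1 E2]]] := halfV_integral cfg e1p e2p VE SE VD.
    have := halfV_integral cfg' e2p e1p VE' SE'; rewrite mem_swap => /(_ SD).
    move=> [i' [j' [E1' E2']]].
    (* With halves of both [V] and [S] in [D], the consecutive integers [e1] and [1 + e1] would both
       be even. *)
    have : ((i + i) = (j' + j').+1)%N.
      by apply/eqP; rewrite -(eqr_nat R) -addn1 !natrD -E1 -E2'; apply/eqP; field.
    by move/(congr1 odd); rewrite /= !addnn !odd_double.
  have [[eD sup _]|[_ neD]] := adjacent_edge cfg e1p e2p VE SE; last first.
    by rewrite -[(e1, e2)]/(swap (e2, e1)) eD' in neD.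
  split=> // t tD; apply: sup'; by rewrite mem_swap swapK.
have N0 : 1 < e1 + e2.
  case: (sum_gt1 cfg e1p e2p VE SE eD) => // -[]; lra.
(* The two edge inequalities add up to exactly this bound. *)
have supD t : t \in D -> t.1 + t.2 <= e1 + e2.
  by move=> tD; have := sup _ tD; have := sup' _ tD; rewrite /edge_fun /=; lra.
have supE t : t \in D -> t.1 + t.2 = e1 + e2 -> t = (e1, e2).
  move=> tD tE; have := sup _ tD; have := sup' _ tD; rewrite /edge_fun /=.
  have -> : t.1 = e1 + e2 - t.2 by lra.
  move=> h1 h2.
  have : (t.2 - e2) * (e1 + e2 - 1) = 0 by lra.
  move/eqP; rewrite mulf_eq0 => /orP[] /eqP ?; last by exfalso; lra.
  by apply: pair_ext => /=; lra.
have Jee : J (e1, e2) (e1, e2) = 0.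
  apply/eqP/negP => /negP J0.
  have [] := unique_sum cfg eD eD J0; rewrite ?VE ?SE /=; try lra.
  move=> p q pD qD E1 E2; left; split; apply: supE => //.
    by have := supD _ pD; have := supD _ qD; lra.
  by have := supD _ pD; have := supD _ qD; lra.
have Jaa : J (1, 0) (1, 0) = 0 by rewrite /J /barycentric_form /=; ring.
have Jbb : J (0, 1) (0, 1) = 0 by rewrite /J /barycentric_form /=; ring.
have Jea : 0 < J (e1, e2) (1, 0).
  have : (e1, e2) <> (1, 0) by case; lra.
  by move/(pl_neg cfg); rewrite -/J Jee Jaa; lra.
have Jeb : 0 < J (e1, e2) (0, 1).
  have : (e1, e2) <> (0, 1) by case; lra.
  by move/(pl_neg cfg); rewrite -/J Jee Jbb; lra.
split=> // p pD; apply: contrapT => pne.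
have p1 : 1 < p.1 + p.2.
  by case: (sum_gt1 cfg e1p e2p VE SE pD) => // E; case: pne; rewrite E !inE eqxx ?orbT.
have [|m] := @seq_argmax _ _ (fun t => t.1 + t.2) [seq t <- D | t != (e1, e2)] p.
  by rewrite mem_filter pD andbT; apply/eqP => E; case: pne; rewrite E !inE eqxx ?orbT.
rewrite mem_filter => /andP[/eqP me mD] mmax.
have m1 : 1 < m.1 + m.2.
  apply: lt_le_trans p1 _; apply: mmax; rewrite mem_filter pD andbT.
  by apply/eqP => E; case: pne; rewrite E !inE eqxx ?orbT.
have mlt : m.1 + m.2 < e1 + e2.
  by rewrite lt_neqAle supD // andbT; apply/eqP => /(supE _ mD).
(* m lies in the cone at e spanned by a - e and b - e *)
have Jem : J (e1, e2) m != 0.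
  have : (e1 + e2 - 1) * J (e1, e2) m
    = edge_fun (e2, e1) (swap m) * J (e1, e2) (1, 0) + edge_fun (e1, e2) m * J (e1, e2) (0, 1)
      + (e1 + e2 - 1 - edge_fun (e2, e1) (swap m) - edge_fun (e1, e2) m) * J (e1, e2) (e1, e2).
    by rewrite /J /barycentric_form /edge_fun /=; ring.
  rewrite Jee mulr0 addr0 => E; apply/eqP => J0; move: E; rewrite J0 mulr0 => /esym/eqP.
  have l1 := sup _ mD; have l2 := sup' _ mD.
  rewrite paddr_eq0 ?mulr_ge0 ?(ltW Jea) ?(ltW Jeb) // !mulf_eq0 (gt_eqF Jea) (gt_eqF Jeb) !orbF.
  by move=> /andP[/eqP + /eqP]; rewrite /edge_fun /=; lra.
have [m1_ge0 m2_ge0] := pl_ge0 cfg mD.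
(* If the sum were [V] or [S], then [m] would be [(1,0)] or [(0,1)], against [m1]. *)
have [] := unique_sum cfg eD mD Jem; rewrite ?VE ?SE /=; try lra.
move=> q q' qD q'D E1 E2.
have [qe|qe] := eqVneq q (e1, e2).
  by left; split=> //; apply: pair_ext; move: E1 E2; rewrite qe /=; lra.
have [q'e|q'e] := eqVneq q' (e1, e2).
  by right; split=> //; apply: pair_ext; move: E1 E2; rewrite q'e /=; lra.
exfalso; have := mmax q; have := mmax q'; rewrite !mem_filter qe q'e qD q'D => /(_ isT) + /(_ isT).
lra.
Qed.

(** Write [c], [a], [b], [e] for the four possible points. Then [(1,0)] is only [c + a] and [S] only
    [b + e], so [F c * F a] and [F b * F e] are negative. Only [c + e] could cancel [a + b], but
    these two terms have the same sign. *)
Lemma planar_sign_absurd (al be ga : R) D F V S e1 e2 :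
  planar_config al be ga D F V S -> 0 < e1 -> 0 < e2 ->
  V = (1 + e1, e2) -> S = (e1, 1 + e2) ->
  let T p q := barycentric_form al be ga p q * F p * F q in
  (exists p q, [/\ p \in D, q \in D, p + q = (1, 0) & T p q < 0]) ->
  (exists p q, [/\ p \in D, q \in D, p + q = S & T p q < 0]) -> False.
Proof.
move=> cfg e1p e2p VE SE T [p [q [pD qD E Tlt]]] [p' [q' [p'D q'D E' Tlt']]].
have [eD Jee N0 D4] := adjacent_points cfg e1p e2p VE SE.
have TC x y : T x y = T y x by rewrite /T form_sym mulrAC.
have Jab : barycentric_form al be ga (1, 0) (0, 1) = ga.
  by rewrite /barycentric_form /=; ring.
have ga0 := pl_ga cfg; have al0 := pl_al cfg; have be0 := pl_be cfg.
have Tca : T (0, 0) (1, 0) < 0.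
  have E1 := congr1 fst E; have E2 := congr1 snd E; rewrite /= in E1 E2.
  move: (D4 _ pD) (D4 _ qD) Tlt E1 E2; rewrite !inE.
  by move=> /or4P[] /eqP -> /or4P[] /eqP -> //=; rewrite ?(TC (1, 0) (0, 0)) //; lra.
have Tbe : T (0, 1) (e1, e2) < 0.
  have E1 := congr1 fst E'; have E2 := congr1 snd E'; rewrite SE /= in E1 E2.
  move: (D4 _ p'D) (D4 _ q'D) Tlt' E1 E2; rewrite !inE.
  by move=> /or4P[] /eqP -> /or4P[] /eqP -> //=; rewrite ?(TC (e1, e2) (0, 1)) //; lra.
have Fca : F (0, 0) * F (1, 0) < 0.
  move: Tca; rewrite /T -mulrA pmulr_rlt0 //.
  by rewrite /barycentric_form /=; lra.
have Jce : 0 < barycentric_form al be ga (0, 0) (e1, e2).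
  rewrite /barycentric_form /=.
  have := mulr_gt0 al0 e1p; have := mulr_gt0 be0 e2p; lra.
have Fbe : F (0, 1) * F (e1, e2) < 0.
  move: Tbe; rewrite /T -mulrA pmulr_rlt0 //.
  have : (e1, e2) <> (0, 1) by case; lra.
  move/(pl_neg cfg); rewrite Jee form_sym.
  have -> : barycentric_form al be ga (0, 1) (0, 1) = 0.
    by rewrite /barycentric_form /=; ring.
  by lra.
have [||[x [y [xD yD Exy Tneg]]]] := pl_bal cfg (pl_a cfg) (pl_b cfg).
- by rewrite Jab gt_eqF.
- by rewrite VE SE !inE => /or4P[] /eqP /= [] *; lra.
have E1 := congr1 fst Exy; have E2 := congr1 snd Exy; rewrite /= in E1 E2.
have pos : 0 < T (1, 0) (0, 1) * T (0, 0) (e1, e2).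
  rewrite /T Jab.
  have -> : ga * F (1, 0) * F (0, 1) *
    (barycentric_form al be ga (0, 0) (e1, e2) * F (0, 0) * F (e1, e2)) =
    ga * barycentric_form al be ga (0, 0) (e1, e2) *
    ((F (0, 0) * F (1, 0)) * (F (0, 1) * F (e1, e2))) by ring.
  by rewrite (mulr_gt0 (mulr_gt0 ga0 Jce)) // nmulr_rgt0.
have {}Tneg : T (1, 0) (0, 1) * T x y < 0 by exact: Tneg.
move: (D4 _ xD) (D4 _ yD) Tneg E1 E2; rewrite !inE.
move=> /or4P[] /eqP -> /or4P[] /eqP ->; try (move=> _ /=; lra).
- by rewrite ltNge (ltW pos).
- by rewrite ltNge -expr2 sqr_ge0.
- by rewrite (TC (0, 1)) ltNge -expr2 sqr_ge0.
- by rewrite (TC (e1, e2)) ltNge (ltW pos).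
Qed.

End Planar.

(** * Separation and support *)

Section Dot.
Variables (R : realType) (r : nat).
Implicit Types (x y z f : 'rV[R]_r) (s : seq 'rV[R]_r).

Lemma dotvC x y : dotv x y = dotv y x.
Proof. by apply: eq_bigr => i _; rewrite mulrC. Qed.

Lemma dotvDl x y z : dotv (x + y) z = dotv x z + dotv y z.
Proof. by rewrite -big_split; apply: eq_bigr => i _; rewrite mxE mulrDl. Qed.

Lemma dotvZl k x z : dotv (k *: x) z = k * dotv x z.
Proof. by rewrite mulr_sumr; apply: eq_bigr => i _; rewrite mxE mulrA. Qed.

Lemma dotvDr x y z : dotv z (x + y) = dotv z x + dotv z y.
Proof. by rewrite dotvC dotvDl !(dotvC z). Qed.

Lemma dotvZr k x z : dotv z (k *: x) = k * dotv z x.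
Proof. by rewrite dotvC dotvZl dotvC. Qed.

Lemma dotvBl x y z : dotv (x - y) z = dotv x z - dotv y z.
Proof. by rewrite -scaleN1r dotvDl dotvZl mulN1r. Qed.

Lemma dotvBr x y z : dotv z (x - y) = dotv z x - dotv z y.
Proof. by rewrite dotvC dotvBl !(dotvC z). Qed.

Lemma dotv0r z : dotv z 0 = 0.
Proof. by rewrite -(scale0r 0) dotvZr mul0r. Qed.

Lemma dotv_gt0 x : x != 0 -> 0 < dotv x x.
Proof.
move=> x0; have ge0 i : true -> 0 <= x 0 i * x 0 i by rewrite -expr2 sqr_ge0.
rewrite lt_neqAle sumr_ge0 // andbT eq_sym; apply: contraNneq x0 => /eqP.
rewrite psumr_eq0 // => /allP xz; apply/eqP/rowP => i; rewrite mxE.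
by have := xz i (mem_index_enum _); rewrite /= mulf_eq0 orbb => /eqP.
Qed.

(* For the step, project along [y] onto the kernel of the functional [f] that
   separates [x] from the other generators but is negative at [y]. *)
Lemma farkas s x :
  (exists2 mu : nat -> R, (forall i, 0 <= mu i) & x = \sum_(i < size s) mu i *: s`_i) \/
  (exists2 f, (forall y, y \in s -> 0 <= dotv f y) & dotv f x < 0).
Proof.
elim: {s}(size s) {-2}s x (erefl (size s)) => [|n IH] s x.
  move/eqP; rewrite size_eq0 => /eqP ->.
  have [->|x0] := eqVneq x 0; first by left; exists (fun=> 0) => //; rewrite big_ord0.
  by right; exists (- x) => //; rewrite -scaleN1r dotvZl mulN1r oppr_lt0 dotv_gt0.
case: s => // y s [sz].
have [[mu mu0 ->]|[f fs fx]] := IH s x sz.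
  left; exists (fun i => if i is i'.+1 then mu i' else 0) => [[|i] //|].
  by rewrite big_ord_recl /= scale0r add0r.
have [fy|fy] := leP 0 (dotv f y).
  by right; exists f => // z; rewrite inE => /predU1P[->|/fs].
pose g z := z - (dotv f z / dotv f y) *: y.
have [|[mu mu0 gx]|[h hs hx]] := IH (map g s) (g x); first by rewrite size_map.
  have mu'0 : 0 <= dotv f x / dotv f y - \sum_(i < size s) mu i * (dotv f s`_i / dotv f y).
    rewrite subr_ge0 (@le_trans _ _ 0) //; last by rewrite mulr_le0 ?invr_le0 ?(ltW fx) ?(ltW fy).
    apply: sumr_le0 => i _; rewrite mulr_ge0_le0 // mulr_ge0_le0 ?invr_le0 ?(ltW fy) //.
    exact/fs/mem_nth.
  left; exists (fun i => if i is i'.+1 then mu i'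
     else dotv f x / dotv f y - \sum_(i < size s) mu i * (dotv f s`_i / dotv f y)) => [[|i] //|].
  transitivity (g x + (dotv f x / dotv f y) *: y); first by rewrite subrK.
  rewrite gx size_map big_ord_recl /= scalerBl scaler_suml [LHS]addrC -[RHS]addrA.
  congr (_ + _); rewrite addrC -sumrB; apply: eq_bigr => i _.
  by rewrite (nth_map 0) // /g scalerBr scalerA.
(* This functional is [h] composed with the projection [g]; it vanishes at [y]. *)
right; exists (h - (dotv h y / dotv f y) *: f).
  move=> z; rewrite inE dotvBl dotvZl => /predU1P[->|zs].
    by rewrite divfK ?subrr // lt_eqF.
  have := hs _ (map_f g zs); rewrite /g dotvBr dotvZr; congr (0 <= _ - _); ring.
by move: hx; rewrite /g dotvBr dotvZr dotvBl dotvZl; congr (_ - _ < 0); ring.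
Qed.

(** For each [p != c], [farkas] yields a functional minimal at [c] and larger at [p]; otherwise [c]
    would lie strictly between [p] and a point of the hull. Their sum over all [p] is strict
    everywhere. *)
Lemma extreme_separation s c : c \in s -> is_extreme (conv_seq s) c ->
  exists h, forall x, x \in s -> x != c -> dotv h c < dotv h x.
Proof.
move=> cs [_ ext].
have sep p : p \in s -> p != c ->
    exists2 f, (forall x, x \in s -> 0 <= dotv f (x - c)) & 0 < dotv f (p - c).
  move=> ps pc; have [[mu mu0 E]|[f fs fx]] := farkas [seq x - c | x <- s] (c - p); last first.
    exists f => [x xs|]; first exact/fs/map_f.
    by rewrite -opprB -scaleN1r dotvZr mulN1r oppr_gt0.
  exfalso; move/eqP: pc; apply.
  pose M := \sum_(i < size s) mu i.
  have E' : c - p = \sum_(i < size s) mu i *: s`_i - M *: c.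
    rewrite E size_map /M scaler_suml -sumrB; apply: eq_bigr => i _.
    by rewrite (nth_map 0) // scalerBr.
  have M0 : 0 <= M by exact: sumr_ge0.
  have [Mz|Mn] := eqVneq M 0.
    have muz (i : 'I_(size s)) : mu i = 0.
      by apply/eqP; move/eqP: Mz; rewrite psumr_eq0 // => /allP/(_ i (mem_index_enum _)).
    apply/eqP; rewrite eq_sym -subr_eq0 E' Mz scale0r subr0 big1 // => i _.
    by rewrite muz scale0r.
  have Mp : 0 < M by rewrite lt_neqAle eq_sym Mn.
  have M1 : 1 + M != 0 by rewrite gt_eqF // addr_gt0.
  have sp : conv_seq s p.
    exists (fun i => (nat_of_ord i == index p s)%:R); split=> [i|]; first exact: ler0n.
    have ip : (index p s < size s)%N by rewrite index_mem.
    split; rewrite (bigD1 (Ordinal ip)) //= eqxx ?scale1r ?nth_index // big1 ?addr0 // => i;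
      by rewrite -val_eqE /= => /negPf ->; rewrite ?scale0r.
  have sy : conv_seq s (M^-1 *: \sum_(i < size s) mu i *: s`_i).
    exists (fun i => M^-1 * mu i); split=> [i|]; first by rewrite mulr_ge0 ?invr_ge0.
    split; first by rewrite -mulr_sumr mulVf.
    by rewrite scaler_sumr; apply: eq_bigr => i _; rewrite scalerA.
  (* Since [(1 + M) *: c] is [p] plus the combination of total weight [M], the point [p] gets weight
     [(1 + M)^-1] in [c]. *)
  have [] := ext _ _ ((1 + M)^-1) sy sp.
  - by rewrite invr_gt0 addr_gt0 //= invf_lt1 ?addr_gt0 // ltrDl.
  - have -> : \sum_(i < size s) mu i *: s`_i = (1 + M) *: c - p.
      by rewrite scalerDl scale1r addrAC E' subrK.
    rewrite scalerA scalerBr scalerA.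
    have -> : (1 - (1 + M)^-1) / M = (1 + M)^-1 by field; rewrite M1 Mn.
    by rewrite mulVf // scale1r subrK.
  by move=> _ ->.
(* Membership is repeated so that the induction runs only over the list on which strictness is
   asked. *)
have [h [hs hp]] : exists h, (forall x, x \in s -> 0 <= dotv h (x - c)) /\
    (forall x, x \in s -> x \in s -> x != c -> 0 < dotv h (x - c)).
  elim: {3}s => [|y t [h [hs ht]]]; first by exists 0; split=> // x _; rewrite dotvC dotv0r.
  have [[ys yc]|nyc] := pselect (y \in s /\ y != c).
    have [f fs fy] := sep y ys yc.
    exists (f + h); split=> x xs; first by rewrite dotvDl addr_ge0 ?fs ?hs.
    rewrite inE dotvDl => /predU1P[->|xt] xc; first by rewrite ltr_wpDr ?hs.
    by rewrite ltr_wpDl ?fs ?ht.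
  exists h; split=> // x xs; rewrite inE => /predU1P[xy xc|]; last exact: ht.
  by case: nyc; rewrite -xy.
exists h => x xs xc; rewrite -subr_gt0 -dotvBr; exact: hp.
Qed.

End Dot.

(** * The form J and its negativity on vectors of coordinate sum zero *)

Section Form.
Variables (R : realType) (r : nat) (d : 'I_r -> nat).
Implicit Types (p q x z : 'rV[R]_r).

Lemma sumvD p q : sumv (p + q) = sumv p + sumv q.
Proof. by rewrite -big_split; apply: eq_bigr => i _; rewrite mxE. Qed.

Lemma sumvZ k p : sumv (k *: p) = k * sumv p.
Proof. by rewrite mulr_sumr; apply: eq_bigr => i _; rewrite mxE. Qed.

Lemma JfC p q : Jf d p q = Jf d q p.
Proof.
rewrite /Jf [sumv p * _]mulrC; congr (_ - _).
by apply: eq_bigr => i _; rewrite [p 0 i * _]mulrC.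
Qed.

Lemma JfDl p p' q : Jf d (p + p') q = Jf d p q + Jf d p' q.
Proof.
rewrite /Jf sumvD mulrDl mulrDr addrACA -opprD -big_split; congr (_ - _).
by apply: eq_bigr => i _; rewrite mxE !mulrDl.
Qed.

Lemma JfZl k p q : Jf d (k *: p) q = k * Jf d p q.
Proof.
rewrite /Jf sumvZ mulrBr; congr (_ - _); first by rewrite -mulrA mulrCA.
by rewrite mulr_sumr; apply: eq_bigr => i _; rewrite mxE -!mulrA.
Qed.

Lemma JfDr p p' q : Jf d q (p + p') = Jf d q p + Jf d q p'.
Proof. by rewrite JfC JfDl !(JfC q). Qed.

Lemma JfZr k p q : Jf d q (k *: p) = k * Jf d q p.
Proof. by rewrite JfC JfZl JfC. Qed.

Lemma JfBB p q : Jf d (p - q) (p - q) = Jf d p p + Jf d q q - 2 * Jf d p q.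
Proof. by rewrite -scaleN1r !(JfDl, JfDr, JfZl, JfZr) (JfC q p); ring. Qed.

Hypothesis d_gt0 : forall i, (0 < d i)%N.

(** Coordinate sum zero leaves only the negative definite diagonal part of J. *)
Lemma Jf_lt0 z : sumv z = 0 -> z != 0 -> Jf d z z < 0.
Proof.
move=> sz z0; rewrite /Jf sz !mulr0 add0r oppr_lt0.
have ge0 i : true -> 0 <= z 0 i * z 0 i / (d i)%:R by rewrite -expr2 divr_ge0 ?sqr_ge0.
rewrite lt_neqAle sumr_ge0 // andbT eq_sym; apply: contraNneq z0 => /eqP.
rewrite psumr_eq0 // => /allP xz; apply/eqP/rowP => i; rewrite mxE.
have := xz i (mem_index_enum _); rewrite /= !mulf_eq0 orbb invr_eq0 pnatr_eq0.
by rewrite (gtn_eqF (d_gt0 i)) orbF => /eqP.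
Qed.

Lemma Jf_inH_lt p q : inH d p -> inH d q -> p != q ->
  Jf d p p + Jf d q q < 2 * Jf d p q.
Proof.
move=> pH qH pq; rewrite -subr_lt0 -JfBB; apply: Jf_lt0; last by rewrite subr_eq0.
by rewrite -scaleN1r sumvD sumvZ pH qH mulN1r subrr.
Qed.

End Form.

(** * Superpotential equations and the cone at the null vertex *)

Section Superpotential.
Variables (R : realType) (r : nat) (d : 'I_r -> nat).
Variables (C : seq 'rV[R]_r) (F : 'rV[R]_r -> R).
Local Notation T p q := (Jf d p q * F p * F q).

Lemma sp_coef_lt0 z : sp_coef d C F z < 0 ->
  exists p q, [/\ p \in C, q \in C, p + q = z & T p q < 0].
Proof.
move=> lt0; apply: contrapT => no.
suff: 0 <= sp_coef d C F z by rewrite leNgt lt0.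
rewrite /sp_coef big_seq; apply: sumr_ge0 => p pC.
rewrite big_seq_cond; apply: sumr_ge0 => q /andP[qC /eqP E].
by rewrite leNgt; apply/negP => Tlt; apply: no; exists p, q.
Qed.

Lemma sp_coef_neq0 z : sp_coef d C F z != 0 ->
  exists p q, [/\ p \in C, q \in C & p + q = z].
Proof.
move=> /eqP neq0; apply: contrapT => no; apply: neq0.
rewrite /sp_coef big_seq big1 // => p pC; rewrite big_seq_cond big1 // => q.
by move=> /andP[qC /eqP E]; case: no; exists p, q.
Qed.

(** Multiply the equation by [T p q]. Were no product negative, nonnegative terms including the
    square of [T p q] would add up to zero. *)
Lemma sp_coef_eq0 p q : sp_coef d C F (p + q) = 0 -> p \in C -> q \in C -> T p q != 0 ->
  exists p' q', [/\ p' \in C, q' \in C, p' + q' = p + q & T p q * T p' q' < 0].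
Proof.
move=> eq0 pC qC T0; apply: contrapT => no; move/negP: T0; apply.
have ge0 p' q' : p' \in C -> q' \in C -> p' + q' = p + q -> 0 <= T p q * T p' q'.
  by move=> ? ? ?; rewrite leNgt; apply/negP => ?; apply: no; exists p', q'.
have ge0' p' : p' \in C ->
    0 <= \sum_(q' <- C | (q' \in C) && (p' + q' == p + q)) T p q * T p' q'.
  by move=> p'C; apply: sumr_ge0 => q' /andP[q'C /eqP]; exact: ge0.
have /eqP : T p q * sp_coef d C F (p + q) = 0 by rewrite eq0 mulr0.
rewrite /sp_coef mulr_sumr big_seq.
under eq_bigr do rewrite mulr_sumr big_seq_cond.
rewrite psumr_eq0 // => /allP/(_ p pC); rewrite pC /= psumr_eq0; last first.
  by move=> q' /andP[q'C /eqP]; exact: ge0.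
by move=> /allP/(_ q qC); rewrite qC eqxx /= mulf_eq0 orbb.
Qed.

Variables (W : seq 'rV[int]_r) (A : 'rV[int]_r -> R) (c : 'rV[R]_r).
Hypothesis d_gt0 : forall i, (0 < d i)%N.
Hypothesis F_neq0 : forall x, x \in C -> F x != 0.
Hypothesis C_inH : forall x, x \in C -> inH d x.
Hypothesis spC : superpotential d W A C F.

Lemma barW_mid w : dR d + intvR w = barW d w + barW d w :> 'rV[R]_r.
Proof. by rewrite /barW -scalerDl -[X in X + X]mul1r -splitr scale1r. Qed.

Lemma unbalanced_sum p q : p \in C -> q \in C -> Jf d p q != 0 ->
  (forall w, w \in W -> p + q != barW d w + barW d w) ->
  exists p' q', [/\ p' \in C, q' \in C, p' + q' = p + q & T p q * T p' q' < 0].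
Proof.
move=> pC qC J0 pqW; apply: sp_coef_eq0 => //; last by rewrite !mulf_neq0 ?F_neq0.
by apply: spC.2 => w wW; rewrite barW_mid pqW.
Qed.

(* If [f] took a smaller value on [C], tilt [f] by a functional exposing [c] until
   it exposes a face [G] of [conv C] through [c] and some other element.  Sums of
   elements of [G], other than [2 c], are not in [d + W], so [J >= 0] on [G], and
   the sum of [c] and the element of [G] next to it cannot be cancelled. *)
Lemma superpotential_support f : c \in C -> null d c -> is_extreme (conv_seq C) c ->
  (forall w, w \in W -> dotv f c <= dotv f (barW d w)) ->
  forall x, x \in C -> dotv f c <= dotv f x.
Proof.
move=> cC cnull cext fW x0 x0C; rewrite leNgt; apply/negP => x0f.
have [h hC] := extreme_separation cC cext.
have x0c : x0 != c by apply: contraTneq x0f => ->; rewrite ltxx.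
(* The least slope is the right tilt: [g] below is nonnegative on [C] and vanishes at [c] and at
   [m]. *)
pose slope x := (dotv f x - dotv f c) / (dotv h x - dotv h c).
have [|m] := @seq_argmin _ _ slope [seq x <- C | x != c] x0.
  by rewrite mem_filter x0c.
rewrite mem_filter => /andP[mc mC] mmin.
have hpos x : x \in C -> x != c -> 0 < dotv h x - dotv h c.
  by move=> xC xc; rewrite subr_gt0 hC.
have m_lt0 : slope m < 0.
  apply: le_lt_trans (mmin x0 _) _; first by rewrite mem_filter x0c.
  by rewrite /slope pmulr_llt0 ?subr_lt0 // invr_gt0 hpos.
pose g x := (dotv f x - dotv f c) - slope m * (dotv h x - dotv h c).
have gD x y x' y' : x + y = x' + y' -> g x + g y = g x' + g y'.
  move=> E; have Ef := congr1 (dotv f) E; have Eh := congr1 (dotv h) E.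
  move: Ef Eh; rewrite !dotvDr /g => Ef Eh.
  have -> : dotv f x = dotv f x' + dotv f y' - dotv f y by rewrite -Ef addrK.
  have -> : dotv h x = dotv h x' + dotv h y' - dotv h y by rewrite -Eh addrK.
  by ring.
have g_ge0 x : x \in C -> 0 <= g x.
  move=> xC; have [->|xc] := eqVneq x c; first by rewrite /g !subrr mulr0 subrr.
  rewrite subr_ge0 -ler_pdivlMr ?hpos //; apply: mmin; by rewrite mem_filter xc.
pose G := [seq x <- C | g x == 0].
have GP x : x \in G -> x \in C /\ g x = 0 by rewrite mem_filter => /andP[/eqP].
have cG : c \in G by rewrite mem_filter cC /g !subrr mulr0 subrr eqxx.
have mG : m \in G.
  rewrite mem_filter mC andbT /g /slope divfK ?subrr //.
  by rewrite gt_eqF // hpos.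
have Gsum x y x' y' : x \in G -> y \in G -> x' \in C -> y' \in C ->
    x' + y' = x + y -> x' \in G /\ y' \in G.
  move=> /GP[xC xg] /GP[yC yg] x'C y'C /gD; rewrite xg yg addr0.
  move=> /eqP; rewrite paddr_eq0 ?g_ge0 // => /andP[x'g y'g].
  by rewrite !mem_filter x'g y'g x'C.
have Gf x : x \in G -> x != c -> dotv f x < dotv f c.
  move=> /GP[xC /eqP]; rewrite subr_eq0 => /eqP E xc.
  by rewrite -subr_lt0 E pmulr_llt0 // hpos.
have Gf' x : x \in G -> dotv f x <= dotv f c.
  by move=> xG; have [->|/(Gf _ xG)/ltW] := eqVneq x c.
have notW x y : x \in G -> y \in G -> y != c ->
    forall w, w \in W -> x + y != barW d w + barW d w.
  move=> xG yG yc w wW; apply/eqP => /(congr1 (dotv f)); rewrite !dotvDr.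
  have := Gf' _ xG; have := Gf _ yG yc; have := fW _ wW; lra.
have [n nG nmin] := seq_argmin (fun x => Jf d x x) cG.
(* If [J(n,n) < 0], then [n + n] has a cancelling pair in [G]. Strict concavity and the minimality
   of [n] force both members to be [n], so the product of terms is a square. *)
have Jn : 0 <= Jf d n n.
  rewrite leNgt; apply/negP => Jn.
  have nc : n != c by apply: contraTneq Jn => ->; rewrite cnull ltxx.
  have nC := (GP _ nG).1.
  have [||p [q [pC qC E]]] := unbalanced_sum nC nC; first by rewrite lt_eqF.
    exact: notW.
  have [pG qG] := Gsum _ _ _ _ nG nG pC qC E.
  have pq : p = q.
    apply/eqP; apply: contraTT (isT) => pq.
    have := Jf_inH_lt d_gt0 (C_inH pC) (C_inH qC) pq.
    have : Jf d (p + q) (p + q) = Jf d (n + n) (n + n) by rewrite E.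
    rewrite !(JfDl, JfDr) (JfC d q p).
    have := nmin _ pG; have := nmin _ qG; lra.
  move: E; rewrite -pq -!mulr2n => /(congr1 (fun z => 2^-1 *: z)).
  rewrite -!scaler_nat !scalerA mulVf ?pnatr_eq0 // !scale1r => ->.
  by rewrite ltNge -expr2 sqr_ge0.
have Jc x : x \in G -> x != c -> 0 < Jf d c x.
  move=> xG xc; have := nmin _ xG; rewrite eq_sym in xc.
  have := Jf_inH_lt d_gt0 (C_inH cC) (C_inH (GP _ xG).1) xc.
  by move: cnull; rewrite /null; lra.
(* With [y] lowest for [h] apart from [c], two elements other than [c] have total height above that
   of [c + y]. *)
have [|y] := @seq_argmin _ _ (dotv h) [seq x <- G | x != c] m.
  by rewrite mem_filter mc.
rewrite mem_filter => /andP[yc yG] ymin.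
have [||p [q [pC qC E]]] := unbalanced_sum cC (GP _ yG).1.
- by rewrite gt_eqF // Jc.
- exact: notW.
have [pG qG] := Gsum _ _ _ _ cG yG pC qC E.
have [pc|pc] := eqVneq p c.
  have -> : q = y by apply: (addrI c); rewrite -E pc.
  by rewrite pc ltNge -expr2 sqr_ge0.
have [qc|qc] := eqVneq q c.
  have -> : p = y by apply: (addrI c); rewrite -E qc addrC.
  by rewrite qc (JfC d y c) [X in _ * X]mulrAC ltNge -expr2 sqr_ge0.
have := ymin p; rewrite mem_filter pc pG => /(_ isT) hp.
have := ymin q; rewrite mem_filter qc qG => /(_ isT) hq _.
have := congr1 (dotv h) E; rewrite !dotvDr.
have := hC _ (GP _ yG).1 yc; lra.
Qed.

(** The dual form, by [farkas], of [superpotential_support]. *)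
Lemma superpotential_cone p : c \in C -> null d c -> is_extreme (conv_seq C) c ->
  p \in C -> let B := map (barW d) W in
  exists2 mu : nat -> R, (forall i, 0 <= mu i) &
    p - c = \sum_(i < size B) mu i *: (B`_i - c).
Proof.
move=> cC cnull cext pC B.
have [[mu mu0 E]|[f fs fx]] := farkas [seq y - c | y <- B] (p - c).
  exists mu => //; rewrite E size_map; apply: eq_bigr => i _.
  by rewrite (nth_map 0).
suff: dotv f c <= dotv f p by rewrite leNgt -subr_lt0 -dotvBr fx.
apply: superpotential_support pC => // w wW.
by rewrite -subr_ge0 -dotvBr; apply/fs/map_f/map_f.
Qed.

End Superpotential.

(** * Faces and planes *)

(** The two outcomes are [u], [w] adjacent and [u], [w] opposite; the second is later refuted by
    [opposite_absurd]. *)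
Lemma parallelogram_relabel (T : zmodType) (u w p1 p2 p3 p4 : T) :
  p1 + p3 = p2 + p4 -> u \in [:: p1; p2; p3; p4] -> w \in [:: p1; p2; p3; p4] ->
  u != w ->
  exists v s, perm_eq [:: u; w; s; v] [:: p1; p2; p3; p4] /\
    (u + s = w + v \/ u + w = s + v).
Proof.
move=> E; rewrite !inE => /or4P[] /eqP -> /or4P[] /eqP ->; rewrite ?eqxx // => _.
- exists p4, p3; split; last by left.
  by apply/permP => P /=; ring.
- exists p2, p4; split; last by right; rewrite E addrC.
  by apply/permP => P /=; ring.
- exists p2, p3; split; last by left; rewrite E addrC.
  by apply/permP => P /=; ring.
- exists p3, p4; split; last by left.
  by apply/permP => P /=; ring.
- exists p1, p4; split; last by left; rewrite -E addrC.
  by apply/permP => P /=; ring.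
- exists p1, p3; split; last by right; rewrite -E addrC.
  by apply/permP => P /=; ring.
- exists p2, p4; split; last by right; rewrite addrC E addrC.
  by apply/permP => P /=; ring.
- exists p4, p1; split; last by left; rewrite addrC E.
  by apply/permP => P /=; ring.
- exists p2, p1; split; last by left; rewrite addrC E addrC.
  by apply/permP => P /=; ring.
- exists p3, p2; split; last by left; rewrite addrC -E.
  by apply/permP => P /=; ring.
- exists p1, p3; split; last by right; rewrite addrC -E addrC.
  by apply/permP => P /=; ring.
- exists p1, p2; split; last by left; rewrite addrC -E addrC.
  by apply/permP => P /=; ring.
Qed.

Section Faces.
Variables (R : realType) (r : nat).
Local Notation V := 'rV[R]_r.
Implicit Types (K Q : V -> Prop) (s : seq V).

(* A point of [K] in the plane of a parallelogram in [Q] is the endpoint of a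
   segment in [K] whose interior contains the centre of the parallelogram. *)
Lemma face_parallelogram K Q (o x y : V) : is_face K Q ->
  (forall s t : R, 0 <= s <= 1 -> 0 <= t <= 1 -> Q (o + s *: x + t *: y)) ->
  forall s t : R, K (o + s *: x + t *: y) -> Q (o + s *: x + t *: y).
Proof.
move=> [QK [_ [_ face]]] Qpar s t Kst.
(* [B] is large enough that prolonging the segment beyond the centre by the fraction [1 / (2 * B)]
   stays in the parallelogram. *)
pose B := 1 + `|2^-1 - s| + `|2^-1 - t|.
have B0 : 0 < B by rewrite /B -addrA ltr_pwDl // addr_ge0.
have bound z : `|z| <= B -> 0 <= 2^-1 + z / B * 2^-1 <= 1.
  move=> zB; have : `|z / B| <= 1 by rewrite normrM normfV (gtr0_norm B0) ler_pdivrMr ?mul1r.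
  by rewrite ler_norml => /andP[? ?]; apply/andP; split; lra.
have bs : `|2^-1 - s| <= B by rewrite /B addrAC lerDr addr_ge0.
have bt : `|2^-1 - t| <= B by rewrite /B lerDr addr_ge0.
have Q1 := Qpar _ _ (bound _ bs) (bound _ bt).
have Q0 : Q (o + 2^-1 *: x + 2^-1 *: y).
  by apply: Qpar; rewrite invr_ge0 ler0n invf_le1 ?ler1n.
have B1 : 1 <= B by rewrite /B -addrA lerDl addr_ge0.
have D0 : 1 + 2 * B != 0 by rewrite gt_eqF //; lra.
have [||//] := face _ _ (2 * B / (1 + 2 * B)) Kst (QK _ Q1).
  apply/andP; split; first by rewrite divr_gt0 //; lra.
  by rewrite ltr_pdivrMr; lra.
set z := (X in Q X); suff -> : z = o + 2^-1 *: x + 2^-1 *: y by [].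
apply/rowP => i; rewrite !mxE; field; rewrite D0 gt_eqF //.
Qed.

Lemma conv_seq_nth s (i : 'I_(size s)) : conv_seq s s`_i.
Proof.
exists (fun j => (j == i)%:R); split=> [j|]; first exact: ler0n.
split; rewrite (bigD1 i) //= eqxx ?scale1r big1 ?addr0 // => j /negPf -> //.
by rewrite scale0r.
Qed.

(** Splitting off one term of weight strictly between 0 and 1 shows the point inside a segment of
    the hull ending at [s_i], so the face property applies. Weight 1 means that the point is
    [s_i]. *)
Lemma face_conv_seq Q s (mu : nat -> R) : is_face (conv_seq s) Q ->
  (forall i, 0 <= mu i) -> \sum_(i < size s) mu i = 1 ->
  Q (\sum_(i < size s) mu i *: s`_i) ->
  forall i : 'I_(size s), mu i != 0 -> Q s`_i.
Proof.
move=> [_ [_ [_ face]]] mu0 mu1 Qm i mui.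
have mi0 : 0 < mu i by rewrite lt_neqAle eq_sym mui mu0.
have rest_ge0 : 0 <= \sum_(j < size s | j != i) mu j by exact: sumr_ge0.
have m1 : \sum_(j < size s | j != i) mu j = 1 - mu i.
  by rewrite -mu1 [in RHS](bigD1 i) //= addrAC subrr add0r.
have [mi1|mi1] := eqVneq (mu i) 1.
  move: Qm; rewrite (bigD1 i) //= mi1 scale1r big1 ?addr0 // => j ji.
  have /eqP := m1; rewrite mi1 subrr psumr_eq0 // => /allP/(_ j (mem_index_enum _)).
  by rewrite ji => /eqP ->; rewrite scale0r.
have ml1 : mu i < 1 by rewrite lt_neqAle mi1 -subr_ge0 -m1.
have n0 : 1 - mu i != 0 by rewrite subr_eq0 eq_sym.
have rest : conv_seq s ((1 - mu i)^-1 *: \sum_(j < size s | j != i) mu j *: s`_j).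
  exists (fun j => (1 - mu i)^-1 * (if j != i then mu j else 0)); split=> [j|].
    by rewrite mulr_ge0 ?invr_ge0 ?subr_ge0 ?(ltW ml1) //; case: ifP.
  split; first by rewrite -mulr_sumr -big_mkcond /= m1 mulVf.
  rewrite scaler_sumr big_mkcond; apply: eq_bigr => j _; rewrite -scalerA.
  by case: ifP => // _; rewrite scale0r scaler0.
have [||//] := face _ _ (mu i) rest (conv_seq_nth i).
  by rewrite mi0.
rewrite scalerA divff // scale1r addrC.
by move: Qm; rewrite (bigD1 i).
Qed.

Lemma conv_seq_parallelogram (p1 p2 p3 p4 : V) a b : p1 + p3 = p2 + p4 ->
  0 <= a <= 1 -> 0 <= b <= 1 ->
  conv_seq [:: p1; p2; p3; p4] (p1 + a *: (p2 - p1) + b *: (p4 - p1)).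
Proof.
move=> E /andP[a0 a1] /andP[b0 b1].
(* Bilinear interpolation weights. *)
pose m := [:: (1 - a) * (1 - b); a * (1 - b); a * b; (1 - a) * b].
exists (fun i => m`_i); split.
  by case=> -[|[|[|[|]]]] //= _; rewrite mulr_ge0 // subr_ge0.
rewrite !big_ord_recl !big_ord0 /=; split; first by ring.
have -> : p3 = p2 + p4 - p1 by rewrite -E addrC addKr.
by apply/rowP => i; rewrite !mxE; ring.
Qed.

End Faces.

(** * Affine coordinates on the plane through [c], [a], [b] *)

Section Plane.
Variables (R : realType) (r : nat).
Local Notation V := 'rV[R]_r.
Variables c a b : V.
Implicit Types (t : R * R).

Definition plane_vec t : V := t.1 *: (a - c) + t.2 *: (b - c).
Definition plane_pt t : V := c + plane_vec t.

Lemma plane_vecD t t' : plane_vec (t + t') = plane_vec t + plane_vec t'.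
Proof. by rewrite /plane_vec !scalerDl addrACA. Qed.

Lemma plane_vecZ k t : plane_vec (k * t.1, k * t.2) = k *: plane_vec t.
Proof. by rewrite /plane_vec -!scalerA -scalerDr. Qed.

Lemma plane_ptE t : plane_pt t = (1 - t.1 - t.2) *: c + t.1 *: a + t.2 *: b.
Proof. by apply/rowP => i; rewrite /plane_pt /plane_vec !mxE; ring. Qed.

Lemma plane_pt00 : plane_pt (0, 0) = c.
Proof. by rewrite plane_ptE /= !scale0r !subr0 scale1r !addr0. Qed.

Lemma plane_pt10 : plane_pt (1, 0) = a.
Proof. by rewrite plane_ptE /= subrr subr0 !scale0r scale1r add0r addr0. Qed.

Lemma plane_pt01 : plane_pt (0, 1) = b.
Proof. by rewrite plane_ptE /= subr0 subrr !scale0r scale1r !add0r. Qed.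

Lemma plane_ptD t t' : plane_pt t + plane_pt t' = c + c + plane_vec (t + t').
Proof. by rewrite plane_vecD addrACA. Qed.

(** Expand in barycentric coordinates; nullness removes the diagonal terms. *)
Lemma Jf_plane d t t' : null d c -> null d a -> null d b ->
  Jf d (plane_pt t) (plane_pt t') =
    barycentric_form (Jf d c a) (Jf d c b) (Jf d a b) t t'.
Proof.
rewrite /null !plane_ptE !(JfDl, JfDr, JfZl, JfZr) => -> -> ->.
by rewrite (JfC d a c) (JfC d b c) (JfC d b a) /barycentric_form; ring.
Qed.

Hypothesis indep : forall x y : R, x *: (a - c) + y *: (b - c) = 0 -> x = 0 /\ y = 0.

Lemma plane_vec_inj t t' : plane_vec t = plane_vec t' -> t = t'.
Proof.
move=> /eqP; rewrite -subr_eq0 /plane_vec opprD addrACA -!scalerBl => /eqP /indep[h1 h2].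
by apply: pair_ext; apply/eqP; rewrite -subr_eq0 ?h1 ?h2.
Qed.

Lemma plane_pt_inj t t' : plane_pt t = plane_pt t' -> t = t'.
Proof. by move=> /addrI; exact: plane_vec_inj. Qed.

Lemma plane_ptD_inj t t' s s' :
  plane_pt t + plane_pt t' = plane_pt s + plane_pt s' -> t + t' = s + s'.
Proof. by rewrite !plane_ptD => /addrI; exact: plane_vec_inj. Qed.

Lemma plane_coords (C : seq V) : exists D : seq (R * R),
  forall t, (t \in D) = (plane_pt t \in C).
Proof.
elim: C => [|z C [D DP]]; first by exists [::].
have [[t0 zE]|no] := pselect (exists t, z = plane_pt t).
  exists (t0 :: D) => t; rewrite !inE DP zE; congr (_ || _).
  by apply/eqP/eqP => [->//|/plane_pt_inj].
exists D => t; rewrite inE DP; case: eqP => //= tz.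
by case: no; exists t.
Qed.

Lemma aff_hull_plane K z : (forall y, K y -> exists t, y = plane_pt t) ->
  aff_hull K z -> exists t, z = plane_pt t.
Proof.
move=> Kpl [k [p [mu [Kp [mu1 ->]]]]].
suff [t E] : exists t, \sum_i mu i *: (p i - c) = plane_vec t.
  exists t; rewrite /plane_pt -E; under [in RHS]eq_bigr do rewrite scalerBr.
  by rewrite sumrB -scaler_suml mu1 scale1r addrC subrK.
elim/big_ind: _ => [|x y [t ->] [t' ->]|i _].
- by exists (0, 0); rewrite /plane_vec !scale0r addr0.
- by exists (t + t'); rewrite plane_vecD.
have [t ->] := Kpl _ (Kp i); exists (mu i * t.1, mu i * t.2).
by rewrite plane_vecZ /plane_pt addrC addKr.
Qed.

End Plane.

(** * The cone over a face *)

Section ConeFace.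
Variables (R : realType) (r : nat) (c a b : 'rV[R]_r).
Variables (S : seq 'rV[R]_r) (Q : 'rV[R]_r -> Prop).
Hypothesis Qface : is_face (conv_seq S) Q.
Hypothesis Qplane : forall t, conv_seq S (plane_pt c a b t) -> Q (plane_pt c a b t).

(** Dividing by the total weight [M] gives a point of the hull in the plane, hence in [Q], and a
    face contains every generator used by one of its points. *)
Lemma cone_face (mu : nat -> R) t : (forall i, 0 <= mu i) ->
  \sum_(i < size S) mu i *: (S`_i - c) = plane_vec c a b t ->
  forall i : 'I_(size S), mu i != 0 -> Q S`_i.
Proof.
move=> mu0 E i mui; pose M := \sum_(i < size S) mu i.
have M0 : M != 0.
  apply: contra mui; rewrite psumr_eq0 // => /allP/(_ i (mem_index_enum _)).
  by [].
have yE : \sum_(i < size S) (M^-1 * mu i) *: S`_i = plane_pt c a b (M^-1 * t.1, M^-1 * t.2).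
  rewrite /plane_pt plane_vecZ -E; under [in RHS]eq_bigr do rewrite scalerBr.
  rewrite sumrB -scaler_suml -/M scalerBr scalerA mulVf // scale1r addrC subrK.
  by rewrite scaler_sumr; apply: eq_bigr => j _; rewrite scalerA.
have M_ge0 : 0 <= M by exact: sumr_ge0.
have muM j : 0 <= M^-1 * mu j by rewrite mulr_ge0 ?invr_ge0.
have muM1 : \sum_(i < size S) M^-1 * mu i = 1 by rewrite -mulr_sumr mulVf.
have Qy : Q (\sum_(i < size S) (M^-1 * mu i) *: S`_i).
  rewrite yE; apply: Qplane; rewrite -yE; exists (fun i => M^-1 * mu i).
  by split=> // j; exact: muM.
by apply: (face_conv_seq Qface muM muM1 Qy); rewrite mulf_neq0 ?invr_eq0.
Qed.

Hypothesis Qcone : forall z, Q z ->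
  exists t, [/\ z = plane_pt c a b t, 0 <= t.1 & 0 <= t.2].

(** Nonnegative weights cannot cancel in [p + q], so each generator used by [p] is used by the sum
    and lies in [Q]. *)
Lemma cone_sum_in_plane p q t t' :
  (exists2 mu : nat -> R, (forall i, 0 <= mu i) &
    p - c = \sum_(i < size S) mu i *: (S`_i - c)) ->
  (exists2 mu : nat -> R, (forall i, 0 <= mu i) &
    q - c = \sum_(i < size S) mu i *: (S`_i - c)) ->
  p + q = plane_pt c a b t + plane_pt c a b t' ->
  exists s, [/\ p = plane_pt c a b s, 0 <= s.1 & 0 <= s.2].
Proof.
move=> [mu mu0 pE] [nu nu0 qE] E.
have Es : \sum_(i < size S) (mu i + nu i) *: (S`_i - c) = plane_vec c a b (t + t').
  under eq_bigr do rewrite scalerDl.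
  rewrite big_split /= -pE -qE addrACA E plane_ptD -opprD addrC addKr //.
have Qi (i : 'I_(size S)) : mu i != 0 -> Q S`_i.
  move=> mui; apply: (cone_face (mu := fun i => mu i + nu i)) Es _ _ => [j|].
    by rewrite addr_ge0.
  by rewrite paddr_eq0 // negb_and mui.
suff [s [Es1 s1 s2]] : exists s, [/\ p - c = plane_vec c a b s, 0 <= s.1 & 0 <= s.2].
  by exists s; split=> //; rewrite /plane_pt -Es1 addrC subrK.
rewrite pE; elim/big_ind: _ => [|x y [s [-> ? ?]] [s' [-> ? ?]]|i _].
- by exists (0, 0); rewrite /plane_vec !scale0r addr0.
- by exists (s + s'); rewrite plane_vecD; split=> //=; rewrite addr_ge0.
have [->|/Qi/Qcone[s [-> s1 s2]]] := eqVneq (mu i) 0.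
  by exists (0, 0); rewrite /plane_vec !scale0r addr0.
exists (mu i * s.1, mu i * s.2); rewrite plane_vecZ /plane_pt addrC addKr.
by split=> //=; rewrite mulr_ge0.
Qed.

End ConeFace.

(** * The superpotential on the plane of the parallelogram *)

Section Core.
Variables (R : realType) (r : nat) (d : 'I_r -> nat).
Local Notation V := 'rV[R]_r.
Variables (W : seq 'rV[int]_r) (A : 'rV[int]_r -> R) (C : seq V) (F : V -> R).
Variables (c a b : V) (u w : 'rV[int]_r) (Q : V -> Prop) (p1 p2 p3 p4 : 'rV[int]_r).
Local Notation pt := (plane_pt c a b).
Local Notation barW := (barW (R := R) d).
Hypothesis d_gt0 : forall i, (0 < d i)%N.
Hypothesis A_neq0 : forall x, x \in W -> A x != 0.
Hypothesis F_neq0 : forall x, x \in C -> F x != 0.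
Hypothesis C_inH : forall x, x \in C -> inH d x.
Hypothesis spC : superpotential d W A C F.
Hypotheses (cC : c \in C) (aC : a \in C) (bC : b \in C).
Hypotheses (cnull : null d c) (anull : null d a) (bnull : null d b).
Hypothesis cext : is_extreme (conv_seq C) c.
Hypotheses (uW : u \in W) (wW : w \in W).
Hypotheses (uE : barW u = 2^-1 *: (a + c)) (wE : barW w = 2^-1 *: (b + c)).
Hypothesis Qface : is_face (Wpoly d W) Q.
Hypotheses (Qu : Q (barW u)) (Qw : Q (barW w)).
Hypothesis Qcone : forall z, Q z -> exists t, [/\ z = pt t, 0 <= t.1, 0 <= t.2,
  t.1 = 0 -> z = barW w & t.2 = 0 -> z = barW u].
Hypotheses (p1W : p1 \in W) (p2W : p2 \in W) (p3W : p3 \in W) (p4W : p4 \in W).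
Hypothesis pE : p1 + p3 = p2 + p4.
Hypothesis pindep : forall al be : R,
  al *: (intvR p2 - intvR p1) + be *: (intvR p4 - intvR p1) = 0 -> al = 0 /\ be = 0.
Hypothesis Qpar : forall x, conv_seq (map (intvR (R := R)) [:: p1; p2; p3; p4]) x ->
  Q (2^-1 *: (dR d + x)).
Hypothesis QW : forall x, x \in W -> Q (barW x) -> x \in [:: p1; p2; p3; p4].

Let intvRD (x y : 'rV[int]_r) : intvR (x + y) = intvR x + intvR y :> V.
Proof. by apply/rowP => i; rewrite !mxE rmorphD. Qed.

Let barW_inj : injective barW.
Proof.
move=> x y E; apply/rowP => i; have := congr1 (fun z : V => z 0 i) E.
rewrite !mxE => /mulfI; rewrite invr_eq0 pnatr_eq0 => /(_ isT)/addrI.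
exact: intr_inj.
Qed.

Lemma barW_sum x y x' y' : x + y = x' + y' -> barW x + barW y = barW x' + barW y'.
Proof.
move=> /(congr1 (intvR (R := R))); rewrite !intvRD /Defs.barW -!scalerDr => E.
by rewrite addrACA E addrACA.
Qed.

Lemma Qpoint x : x \in [:: p1; p2; p3; p4] -> Q (barW x).
Proof.
move=> xp; apply: Qpar.
have : intvR x \in map (intvR (R := R)) [:: p1; p2; p3; p4] by exact: map_f.
move=> /[dup] xm; rewrite -index_mem => xs.
by rewrite -(nth_index 0 xm); exact: (conv_seq_nth (Ordinal xs)).
Qed.

Let barWB x y : barW x - barW y = 2^-1 *: (intvR x - intvR y).
Proof. by rewrite -scalerBr opprD addrACA subrr add0r. Qed.

Let pin : [/\ p1 \in [:: p1; p2; p3; p4], p2 \in [:: p1; p2; p3; p4],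
  p3 \in [:: p1; p2; p3; p4] & p4 \in [:: p1; p2; p3; p4]].
Proof. by rewrite !inE !eqxx !orbT. Qed.

(** The determinant of the two sides in plane coordinates; its nonvanishing allows Cramer's rule
    below. *)
Lemma side_coords : exists t1 t2 t4, [/\ barW p1 = pt t1, barW p2 = pt t2, barW p4 = pt t4 &
  (t2.1 - t1.1) * (t4.2 - t1.2) - (t4.1 - t1.1) * (t2.2 - t1.2) != 0].
Proof.
have [/Qpoint/Qcone[t1 [E1 _ _ _ _]] /Qpoint/Qcone[t2 [E2 _ _ _ _]] _
  /Qpoint/Qcone[t4 [E4 _ _ _ _]]] := pin.
exists t1, t2, t4; split=> //; apply/eqP => det0.
have side al be : al *: (intvR p2 - intvR p1) + be *: (intvR p4 - intvR p1) =
    2 *: plane_vec c a b (al * (t2.1 - t1.1) + be * (t4.1 - t1.1),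
                          al * (t2.2 - t1.2) + be * (t4.2 - t1.2)).
  have H x y : intvR x - intvR y = 2 *: (barW x - barW y).
    by rewrite barWB scalerA divff ?pnatr_eq0 // scale1r.
  rewrite !H E1 E2 E4 !plane_ptE /plane_vec /=.
  by apply/rowP => i; rewrite !mxE; ring.
have z al be : al * (t2.1 - t1.1) + be * (t4.1 - t1.1) = 0 ->
    al * (t2.2 - t1.2) + be * (t4.2 - t1.2) = 0 -> al = 0 /\ be = 0.
  by move=> z1 z2; apply: pindep; rewrite side z1 z2 /plane_vec !scale0r addr0 scaler0.
(* With determinant zero these coefficients give relations between the sides, so every entry
   vanishes; then the coefficients 1 and 0 give a relation too. *)
have [] := z (t4.2 - t1.2) (- (t2.2 - t1.2)); [lra|lra|move=> y4 y2].
have [] := z (t4.1 - t1.1) (- (t2.1 - t1.1)); [lra|lra|move=> x4 x2].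
have [] := z 1 0; [lra|lra|move=> /eqP; by rewrite oner_eq0].
Qed.

(** Cramer's rule turns a relation between [a - c] and [b - c] into one between the sides. *)
Lemma plane_indep x y : x *: (a - c) + y *: (b - c) = 0 -> x = 0 /\ y = 0.
Proof.
have [t1 [t2 [t4 [E1 E2 E4 det]]]] := side_coords.
move: det; set det := (X in X != 0) => det0 xy0.
pose al := (x * (t4.2 - t1.2) - y * (t4.1 - t1.1)) / det.
pose be := (y * (t2.1 - t1.1) - x * (t2.2 - t1.2)) / det.
have X : al * (t2.1 - t1.1) + be * (t4.1 - t1.1) = x by rewrite /al /be /det; field.
have Y : al * (t2.2 - t1.2) + be * (t4.2 - t1.2) = y by rewrite /al /be /det; field.
have [] := @pindep al be.
  have H z z' : intvR z - intvR z' = 2 *: (barW z - barW z').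
    by rewrite barWB scalerA divff ?pnatr_eq0 // scale1r.
  rewrite !H E1 E2 E4; transitivity (2 *: (x *: (a - c) + y *: (b - c))).
    rewrite -X -Y !plane_ptE; apply/rowP => i; rewrite !mxE; ring.
  by rewrite xy0 scaler0.
by move=> al0 be0; rewrite -X -Y al0 be0 !mul0r addr0.
Qed.

(** Cramer's rule expresses [t] through the sides, and [face_parallelogram] applies. *)
Lemma Qplane t : Wpoly d W (pt t) -> Q (pt t).
Proof.
have [t1 [t2 [t4 [E1 E2 E4 det]]]] := side_coords.
move: det; set det := (X in X != 0) => det0.
pose al := ((t.1 - t1.1) * (t4.2 - t1.2) - (t.2 - t1.2) * (t4.1 - t1.1)) / det.
pose be := ((t.2 - t1.2) * (t2.1 - t1.1) - (t.1 - t1.1) * (t2.2 - t1.2)) / det.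
have X : t.1 = t1.1 + al * (t2.1 - t1.1) + be * (t4.1 - t1.1) by rewrite /al /be /det; field.
have Y : t.2 = t1.2 + al * (t2.2 - t1.2) + be * (t4.2 - t1.2) by rewrite /al /be /det; field.
have -> : pt t = barW p1 + al *: (barW p2 - barW p1) + be *: (barW p4 - barW p1).
  rewrite E1 E2 E4 !plane_ptE X Y; apply/rowP => i; rewrite !mxE; ring.
apply: face_parallelogram => // x y x01 y01.
have -> : barW p1 + x *: (barW p2 - barW p1) + y *: (barW p4 - barW p1) =
    2^-1 *: (dR d + (intvR p1 + x *: (intvR p2 - intvR p1) + y *: (intvR p4 - intvR p1))).
  by apply/rowP => i; rewrite !mxE; ring.
by apply: Qpar; apply: conv_seq_parallelogram; rewrite // -!intvRD pE.
Qed.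

Lemma barW_Wpoly x : x \in W -> Wpoly d W (barW x).
Proof.
move=> /(map_f barW) /[dup] xm; rewrite -index_mem => xs.
by rewrite -(nth_index 0 xm); exact: (conv_seq_nth (Ordinal xs)).
Qed.

(** This restricts the equations to the plane: pairs cancelling a sum of plane elements stay in the
    plane, even in its quadrant. *)
Lemma sum_in_plane p q t t' : p \in C -> q \in C -> p + q = pt t + pt t' ->
  exists s s', [/\ p = pt s, q = pt s', 0 <= s.1 /\ 0 <= s.2 & 0 <= s'.1 /\ 0 <= s'.2].
Proof.
move=> pC qC E; have Qc z : Q z -> exists t, [/\ z = pt t, 0 <= t.1 & 0 <= t.2].
  by move=> /Qcone[y []]; exists y.
have cone x : x \in C -> let B := map barW W in
    exists2 mu : nat -> R, (forall i, 0 <= mu i) &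
      x - c = \sum_(i < size B) mu i *: (B`_i - c).
  move=> xC; exact: (superpotential_cone d_gt0 F_neq0 C_inH spC cC cnull cext xC).
have [s [sE s1 s2]] := cone_sum_in_plane Qface Qplane Qc (cone p pC) (cone q qC) E.
rewrite addrC in E.
have [s' [s'E s'1 s'2]] := cone_sum_in_plane Qface Qplane Qc (cone q qC) (cone p pC) E.
by exists s, s'.
Qed.

Lemma inH_plane t : inH d (pt t).
Proof.
rewrite /inH plane_ptE !sumvD !sumvZ.
by rewrite (C_inH cC) (C_inH aC) (C_inH bC); ring.
Qed.

Local Notation J := (barycentric_form (Jf d c a) (Jf d c b) (Jf d a b)).

Lemma plane_form_lt p q : p <> q -> J p p + J q q < 2 * J p q.
Proof.
move=> pq; rewrite -!Jf_plane //; apply: Jf_inH_lt => //; try exact: inH_plane.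
by apply/eqP => /(plane_pt_inj plane_indep).
Qed.

Lemma barWu_sum : barW u + barW u = pt (1, 0) + pt (0, 0).
Proof.
by rewrite plane_pt10 plane_pt00 uE -scalerDl -[X in X + X]mul1r -splitr scale1r.
Qed.

Lemma barWw_sum : barW w + barW w = pt (0, 1) + pt (0, 0).
Proof.
by rewrite plane_pt01 plane_pt00 wE -scalerDl -[X in X + X]mul1r -splitr scale1r.
Qed.

Lemma uniq_parallelogram : uniq [:: p1; p2; p3; p4].
Proof.
have p3E : p3 = p2 + p4 - p1 by rewrite -pE addrC addKr.
have H al be : al *: (intvR p2 - intvR p1) + be *: (intvR p4 - intvR p1) = 0 :> V ->
    al = 0 by move=> /pindep[].
have H' al be : al *: (intvR p2 - intvR p1) + be *: (intvR p4 - intvR p1) = 0 :> V ->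
    be = 0 by move=> /pindep[].
have one0 : (1 : R) = 0 -> False by move/eqP; rewrite oner_eq0.
have q3 : intvR p3 = intvR p2 + intvR p4 - intvR p1 :> V.
  by rewrite p3E; apply/rowP => i; rewrite !mxE rmorphB rmorphD.
rewrite /= !inE !negb_or !andbT.
apply/and3P; split; [apply/and3P; split|apply/andP; split|];
  apply/eqP => E; apply: one0.
- by apply: (H _ 0); rewrite E subrr scale0r scaler0 addr0.
- apply: (H _ 1); apply/rowP => i; have := congr1 (fun z : V => z 0 i) q3.
  by rewrite E !mxE; lra.
- by apply: (H' 0); rewrite E subrr scale0r scaler0 addr0.
- apply: (H' 0); apply/rowP => i; have := congr1 (fun z : V => z 0 i) q3.
  by rewrite E !mxE; lra.
- by apply: (H _ (-1)); rewrite E scale1r scaleN1r subrr.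
- apply: (H _ 0); apply/rowP => i; have := congr1 (fun z : V => z 0 i) q3.
  by rewrite E !mxE; lra.
Qed.

Lemma parallelogram_config v s D tv ts :
  perm_eq [:: u; w; s; v] [:: p1; p2; p3; p4] ->
  (forall t, (t \in D) = (pt t \in C)) -> barW v = pt tv -> barW s = pt ts ->
  planar_config (Jf d c a) (Jf d c b) (Jf d a b) D (F \o pt) (tv + tv) (ts + ts).
Proof.
move=> perm DE vE sE.
have ulist x : x \in [:: p1; p2; p3; p4] -> [\/ x = u, x = w, x = s | x = v].
  rewrite -(perm_mem perm) !inE => /or4P[] /eqP;
  by [constructor 1|constructor 2|constructor 3|constructor 4].
have inlist x : x \in [:: u; w; s; v] -> x \in [:: p1; p2; p3; p4].
  by rewrite (perm_mem perm).
have listW x : x \in [:: p1; p2; p3; p4] -> x \in W.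
  by rewrite !inE => /or4P[] /eqP ->.
have Qv : Q (barW v) by apply/Qpoint/inlist; rewrite !inE eqxx !orbT.
have Qs : Q (barW s) by apply/Qpoint/inlist; rewrite !inE eqxx !orbT.
have vW : v \in W by apply/listW/inlist; rewrite !inE eqxx !orbT.
have sW : s \in W by apply/listW/inlist; rewrite !inE eqxx !orbT.
have := uniq_parallelogram; rewrite -(perm_uniq perm) /= !inE !negb_or.
move=> /and4P[/and3P[/eqP uw /eqP us /eqP uv] /andP[/eqP ws /eqP wv] /eqP sv _].
(* A zero coordinate puts the point on a boundary ray of the quadrant, which meets [Q] only at
   [barW u] or [barW w]. *)
have pos x t : Q (barW x) -> barW x = pt t -> u <> x -> w <> x ->
    0 < (t + t).1 /\ 0 < (t + t).2.
  move=> /Qcone[t' [xE t1 t2 h1 h2]]; rewrite {1}xE.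
  move=> /(plane_pt_inj plane_indep) <- ux wx.
  have t1' : 0 < t'.1.
    rewrite lt_neqAle t1 andbT; apply/eqP => t0; apply: wx.
    by apply/barW_inj/esym/h1.
  have t2' : 0 < t'.2.
    rewrite lt_neqAle t2 andbT; apply/eqP => t0; apply: ux.
    by apply/barW_inj/esym/h2.
  by split; rewrite addr_gt0.
have form0 t : J (0, 0) t = Jf d c a * t.1 + Jf d c b * t.2.
  by rewrite /barycentric_form /=; ring.
have lt_ca : 0 < Jf d c a.
  have /plane_form_lt : (0, 0) <> (1, 0) :> R * R by case; lra.
  by rewrite /barycentric_form /=; lra.
have lt_cb : 0 < Jf d c b.
  have /plane_form_lt : (0, 0) <> (0, 1) :> R * R by case; lra.
  by rewrite /barycentric_form /=; lra.
have lt_ab : 0 < Jf d a b.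
  have /plane_form_lt : (1, 0) <> (0, 1) :> R * R by case; lra.
  by rewrite /barycentric_form /=; lra.
have sums x t : x \in W -> barW x = pt t ->
    exists p q, [/\ p \in D, q \in D & p + q = t + t].
  move=> xW xE; have [|p [q [pC qC E]]] := @sp_coef_neq0 _ _ d C F (dR d + intvR x).
    by rewrite spC.1 // A_neq0.
  rewrite barW_mid xE in E.
  have [y [y' [yE y'E _ _]]] := sum_in_plane pC qC E.
  exists y, y'; rewrite !DE -yE -y'E; split=> //.
  by apply: (plane_ptD_inj plane_indep); rewrite -yE -y'E.
split=> //.
- exact: plane_form_lt.
- by rewrite DE plane_pt00.
- by rewrite DE plane_pt10.
- by rewrite DE plane_pt01.
- move=> p; rewrite DE => pC.
  have [y [y' [yE _ y0 _]]] := sum_in_plane pC pC (erefl (pt p + pt p)).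
  by rewrite (plane_pt_inj plane_indep yE).
- exact: pos Qv vE uv wv.
- exact: pos Qs sE us ws.
- exact: sums vW vE.
- exact: sums sW sE.
move=> p q; rewrite !DE => pC qC J0.
(* If the sum is twice [barW x], then [barW x] is a midpoint in the plane, hence in [Q], and [x] is
   one of the four vertices. *)
have [[x [xW xE]]|noW] := pselect (exists x, x \in W /\ pt p + pt q = barW x + barW x).
  left; have xpt : barW x = pt (2^-1 * (p + q).1, 2^-1 * (p + q).2).
    rewrite /plane_pt plane_vecZ plane_vecD.
    have -> : barW x = 2^-1 *: (barW x + barW x).
      by rewrite -[X in X + X]scale1r -scalerDl scalerA mulVf ?scale1r // pnatr_eq0.
    rewrite -xE plane_ptD plane_vecD scalerDr; congr (_ + _).
    by rewrite -[X in X + X]scale1r -scalerDl scalerA mulVf ?scale1r // pnatr_eq0.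
  have Qx : Q (barW x) by rewrite xpt; apply: Qplane; rewrite -xpt; exact: barW_Wpoly.
  rewrite !inE; case: (ulist x (QW xW Qx)) => xe; rewrite xe in xE.
  - move: xE; rewrite barWu_sum => /(plane_ptD_inj plane_indep) ->.
    by rewrite addr0 eqxx.
  - move: xE; rewrite barWw_sum => /(plane_ptD_inj plane_indep) ->.
    by rewrite addr0 eqxx orbT.
  - by move: xE; rewrite sE => /(plane_ptD_inj plane_indep) ->; rewrite eqxx !orbT.
  - by move: xE; rewrite vE => /(plane_ptD_inj plane_indep) ->; rewrite eqxx !orbT.
right; have [||p' [q' [p'C q'C E Tlt]]] := unbalanced_sum F_neq0 spC pC qC.
- by rewrite Jf_plane.
- by move=> x xW; apply/eqP => xE; apply: noW; exists x.
have [y [y' [yE y'E _ _]]] := sum_in_plane p'C q'C E.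
exists y, y'; rewrite !DE -yE -y'E; split=> //.
  by apply: (plane_ptD_inj plane_indep); rewrite -yE -y'E.
by move: Tlt; rewrite yE y'E !Jf_plane.
Qed.

Lemma parallelogram_C : exists v s,
  perm_eq [:: u; w; s; v] [:: p1; p2; p3; p4] /\ u + s = w + v /\
  (exists e, null d e /\
    (forall x, (x \in C /\ aff_hull Q x) <-> x \in [:: c; a; b; e]) /\
    barW v = 2^-1 *: (a + e) /\ barW s = 2^-1 *: (b + e)) /\
  (A u < 0 -> A s < 0 -> False).
Proof.
have uw : u != w.
  apply/eqP => uw; have /(plane_ptD_inj plane_indep)/(congr1 fst)/eqP :
      pt (1, 0) + pt (0, 0) = pt (0, 1) + pt (0, 0) by rewrite -barWu_sum -barWw_sum uw.
  by rewrite /= !addr0 oner_eq0.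
have [v [s [perm uswv]]] := parallelogram_relabel pE (QW uW Qu) (QW wW Qw) uw.
exists v, s; split=> //.
have Qx x : x \in [:: u; w; s; v] -> Q (barW x).
  by rewrite (perm_mem perm); exact: Qpoint.
have /Qcone[tv [vE _ _ _ _]] : Q (barW v) by apply: Qx; rewrite !inE eqxx !orbT.
have /Qcone[ts [sE _ _ _ _]] : Q (barW s) by apply: Qx; rewrite !inE eqxx !orbT.
have [D DE] := plane_coords plane_indep C.
have cfg := parallelogram_config perm DE vE sE.
case: uswv => uswv; last first.
  case: (opposite_absurd cfg).
  have E := barW_sum uswv; have : barW u + barW u + (barW w + barW w) =
    barW s + barW s + (barW v + barW v) by rewrite addrACA E addrACA.
  rewrite barWu_sum barWw_sum sE vE !plane_ptD addrACA.
  rewrite [RHS]addrACA -!plane_vecD => /addrI/(plane_vec_inj plane_indep) sumE.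
  by rewrite addrC -sumE; apply: pair_ext; rewrite /= ?addr0 ?add0r.
pose e : R * R := (tv + tv) - (1, 0).
have eE : (e.1, e.2) = e by case: (e).
(* In coordinates [u + s = w + v] reads [(1,0) + S = (0,1) + V]. *)
have tsE : ts + ts = e + (0, 1).
  have E := barW_sum uswv; have : barW u + barW u + (barW s + barW s) =
    barW w + barW w + (barW v + barW v) by rewrite addrACA E addrACA.
  rewrite barWu_sum barWw_sum sE vE !plane_ptD addrACA.
  rewrite [RHS]addrACA -!plane_vecD => /addrI/(plane_vec_inj plane_indep) sumE.
  have := congr1 fst sumE; have := congr1 snd sumE => /= h2 h1.
  by rewrite /e; apply: pair_ext => /=; lra.
have VE : tv + tv = (1 + e.1, e.2).
  by rewrite /e; apply: pair_ext; rewrite /=; ring.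
have SE : ts + ts = (e.1, 1 + e.2).
  by rewrite tsE; apply: pair_ext; rewrite /=; ring.
have e1 : 0 < e.1 by have := (pl_S cfg).1; rewrite SE.
have e2 : 0 < e.2 by have := (pl_V cfg).2; rewrite VE.
have [eD Jee N0 D4] := adjacent_points cfg e1 e2 VE SE.
have halfE x y z : pt x + pt x = y + z -> pt x = 2^-1 *: (y + z).
  by move=> <-; rewrite -[X in X + X]scale1r -scalerDl scalerA mulVf ?scale1r ?pnatr_eq0.
have Qpl y : Q y -> exists t, y = pt t by move=> /Qcone[t []]; exists t.
split=> //; split; last first.
  move=> Au As; apply: (planar_sign_absurd cfg e1 e2 VE SE).
    have [|p [q [pC qC E Tlt]]] := @sp_coef_lt0 _ _ d C F (dR d + intvR u).
      by rewrite spC.1.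
    rewrite barW_mid barWu_sum in E.
    have [y [y' [yE y'E _ _]]] := sum_in_plane pC qC E.
    exists y, y'; rewrite !DE -yE -y'E; split=> //.
      by rewrite -[RHS]addr0; apply: (plane_ptD_inj plane_indep); rewrite -yE -y'E.
    by move: Tlt; rewrite yE y'E !Jf_plane.
  have sW : s \in W.
    have : s \in [:: p1; p2; p3; p4] by rewrite -(perm_mem perm) !inE eqxx !orbT.
    by rewrite !inE => /or4P[] /eqP ->.
  have [|p [q [pC qC E Tlt]]] := @sp_coef_lt0 _ _ d C F (dR d + intvR s).
    by rewrite spC.1.
  rewrite barW_mid sE in E.
  have [y [y' [yE y'E _ _]]] := sum_in_plane pC qC E.
  exists y, y'; rewrite !DE -yE -y'E; split=> //.
    by apply: (plane_ptD_inj plane_indep); rewrite -yE -y'E.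
  by move: Tlt; rewrite yE y'E !Jf_plane.
(* Barycentric coordinates with respect to [u], [w], [v], at [(1/2,0)], [(0,1/2)], [tv]. Total
   weight 1 determines [m], as [2 * tv.1 + 2 * tv.2 - 1] is [e.1 + e.2]. *)
have aff t : aff_hull Q (pt t).
  pose m := (2 * t.1 + 2 * t.2 - 1) / (e.1 + e.2).
  pose mu := [:: 2 * (t.1 - m * tv.1); 2 * (t.2 - m * tv.2); m].
  pose pp := [:: barW u; barW w; barW v].
  exists 2, (fun i => pp`_i), (fun i => mu`_i); split.
    by case=> -[|[|[|]]] //= _; apply: Qx; rewrite !inE eqxx ?orbT.
  have v1 : tv.1 = (1 + e.1) / 2.
    by have /(congr1 fst) /= := VE; lra.
  have v2 : tv.2 = e.2 / 2.
    by have /(congr1 snd) /= := VE; lra.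
  have nz : e.1 + e.2 != 0 by have := ltr_wpDl (ltW e1) e2; case: ltgtP.
  have mE : m * (e.1 + e.2) = 2 * t.1 + 2 * t.2 - 1 by rewrite /m divfK.
  have sum1 : 2 * (t.1 - m * tv.1) + (2 * (t.2 - m * tv.2) + m) = 1.
    by rewrite v1 v2; lra.
  rewrite !big_ord_recl !big_ord0 /= !addr0; split=> //.
  have -> : barW u = pt (2^-1, 0).
    by rewrite uE plane_ptE; apply/rowP => i; rewrite !mxE /=; field.
  have -> : barW w = pt (0, 2^-1).
    by rewrite wE plane_ptE; apply/rowP => i; rewrite !mxE /=; field.
  rewrite vE !plane_ptE /=; apply/rowP => i; rewrite !mxE v1 v2.
  by have := congr1 (fun z => z * c 0 i) mE; lra.
exists (pt e); split; [|split; [|split]].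
- by rewrite /null Jf_plane // -eE.
- move=> x; split=> [[xC /(aff_hull_plane Qpl)[t xE]]|].
    have := D4 t; rewrite DE -xE => /(_ xC); rewrite xE !inE.
    move=> /or4P[] /eqP ->; rewrite ?plane_pt00 ?plane_pt10 ?plane_pt01 ?eqxx ?orbT //.
  rewrite !inE => /or4P[] /eqP ->.
  + by split=> //; rewrite -(plane_pt00 c a b); exact: aff.
  + by split=> //; rewrite -(plane_pt10 c a b); exact: aff.
  + by split=> //; rewrite -(plane_pt01 c a b); exact: aff.
  + by split=> //; rewrite -DE -eE.
- rewrite vE; apply: halfE; rewrite -[X in X + pt e](plane_pt10 c a b).
  rewrite !plane_ptD VE; congr (_ + plane_vec _ _ _ _).
  by apply: pair_ext; rewrite /= ?add0r.
- rewrite sE; apply: halfE; rewrite -[X in X + pt e](plane_pt01 c a b).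
  rewrite !plane_ptD SE; congr (_ + plane_vec _ _ _ _).
  by apply: pair_ext; rewrite /= ?add0r.
Qed.

End Core.

(** * From the projection to the plane *)

Lemma proj_ray (R : realType) (r : nat) (K : 'rV[R]_r -> Prop) (c lam z : 'rV[R]_r) beta :
  dotv lam c < beta -> (forall y, K y -> beta < dotv lam y) -> K z ->
  exists2 k, 0 < k & proj c lam beta z = c + k *: (z - c).
Proof.
move=> cb Kb /Kb zb; exists ((beta - dotv lam c) / (dotv lam z - dotv lam c)) => //.
by rewrite divr_gt0 // subr_gt0 // (lt_trans cb).
Qed.

(** A point of [K] projecting to [x] lies on the line through [c] and [x], so it is the unique point
    [z]. *)
Lemma extreme_proj_ray (R : realType) (r : nat) (K : 'rV[R]_r -> Prop)
    (c lam x z : 'rV[R]_r) beta :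
  dotv lam c < beta -> (forall y, K y -> beta < dotv lam y) ->
  (exists y, K y /\ x = proj c lam beta y) ->
  (forall y, K y /\ on_line c x y <-> y = z) ->
  [/\ K z, x = proj c lam beta z & exists2 k, 0 < k & x = c + k *: (z - c)].
Proof.
move=> cb Kb [y [Ky xE]] zP; have [k k0 yE] := proj_ray cb Kb Ky.
have yz : y = z.
  apply/zP; split=> //; exists k^-1; rewrite xE yE addrAC subrr add0r scalerA.
  by rewrite mulVf ?gt_eqF // scale1r addrC subrK.
by subst y; split=> //; exists k => //; rewrite xE.
Qed.

Theorem theorem6p4 (R : realType) (r : nat) (d : 'I_r -> nat)
    (W : seq 'rV[int]_r) (A : 'rV[int]_r -> R)
    (C : seq 'rV[R]_r) (F : 'rV[R]_r -> R)
    (c lam : 'rV[R]_r) (beta : R)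
    (xi xi' : 'rV[R]_r) (u w : 'rV[int]_r) (a a' : 'rV[R]_r)
    (p1 p2 p3 p4 : 'rV[int]_r) :
  (* standing assumptions *)
  (2 <= r)%N ->
  (forall i, (0 < d i)%N) ->
  uniq W ->
  (forall x, x \in W -> typeI x \/ typeII x \/ typeIII x) ->
  (forall x, x \in W -> A x != 0) ->
  (forall x, x \in W -> typeI x -> 0 < A x) ->
  (forall x, x \in W -> ~ typeI x -> A x < 0) ->
  affdim_eq (conv_seq (map (intvR (R:=R)) W)) r.-1 ->
  uniq C ->
  (forall x, x \in C -> F x != 0) ->
  (forall x, x \in C -> inH d x) ->
  superpotential d W A C F ->
  (* c̄ is a null vertex of conv(C) outside conv((d+W)/2) *)
  c \in C -> null d c -> is_extreme (conv_seq C) c -> ~ Wpoly d W c ->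
  (* H' = {x in H | lam.x = beta} strictly separates c̄ from conv((d+W)/2) *)
  dotv lam c < beta -> (forall z, Wpoly d W z -> beta < dotv lam z) ->
  let P := proj c lam beta in
  let Delta := fun x => exists z, Wpoly d W z /\ x = P z in
  let Pinv := fun z => Wpoly d W z /\ segment xi xi' (P z) in
  let E := aff_hull Pinv in
  (* xi, xi' adjacent vertices of Delta, both of type (1B) *)
  adjacent_vertices Delta xi xi' ->
  u \in W -> w \in W ->
  a \in C -> a' \in C -> null d a -> null d a' ->
  (forall z, Wpoly d W z /\ on_line c xi z <-> z = barW (R:=R) d u) ->
  barW (R:=R) d u = 2^-1 *: (a + c) ->
  (forall z, Wpoly d W z /\ on_line c xi' z <-> z = barW (R:=R) d w) ->
  barW (R:=R) d w = 2^-1 *: (a' + c) ->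
  (* P^{-1}(xi xi') is a 2-dimensional face *)
  is_face (Wpoly d W) Pinv -> affdim_eq Pinv 2 ->
  (* its corresponding face of conv(W) is the parallelogram p1 p2 p3 p4 *)
  p1 \in W -> p2 \in W -> p3 \in W -> p4 \in W ->
  p1 + p3 = p2 + p4 ->
  (forall al be : R, al *: (intvR p2 - intvR p1) + be *: (intvR p4 - intvR p1) = 0
     -> al = 0 /\ be = 0) ->
  (forall x, conv_seq (map (intvR (R:=R)) W) x /\ Pinv (2^-1 *: (dR d + x))
     <-> conv_seq (map (intvR (R:=R)) [:: p1; p2; p3; p4]) x) ->
  (* the four vertices are the only elements of W in the face *)
  (forall x, x \in W -> Pinv (barW (R:=R) d x) -> x \in [:: p1; p2; p3; p4]) ->
  exists v s : 'rV[int]_r,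
    (* cyclic order u, w, s, v: u,w adjacent; v adj. to u; s adj. to w *)
    perm_eq [:: u; w; s; v] [:: p1; p2; p3; p4] /\ u + s = w + v /\
    let caseI := exists e, null d e /\
        (forall x, (x \in C /\ E x) <-> x \in [:: c; a; a'; e]) /\
        barW (R:=R) d v = 2^-1 *: (a + e) /\ barW (R:=R) d s = 2^-1 *: (a' + e) in
    let caseII := barW (R:=R) d v \in C /\ barW (R:=R) d s \in C /\
        Jf d a (barW (R:=R) d v) = 0 /\ Jf d a' (barW (R:=R) d s) = 0 /\
        Jf d (barW (R:=R) d s) (barW (R:=R) d v) = 0 in
    (caseI \/ caseII) /\
    (~ typeI v /\ ~ typeI u /\ ~ typeI s /\ ~ typeI w -> ~ caseI).
Proof.
move=> _ d_gt0 _ _ A_neq0 _ A_lt0 _ _ F_neq0 C_inH spC cC cnull cext _ c_lt W_gt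
  P Delta Pinv E [[xiD _] [[xi'D _] [_ _]]] uW wW aC a'C anull a'null
  uline uE wline wE Pface _ p1W p2W p3W p4W pE pindep Ppar PW.
have [Ku xiE [k k0 xik]] := extreme_proj_ray c_lt W_gt xiD uline.
have [Kw xi'E [k' k'0 xi'k]] := extreme_proj_ray c_lt W_gt xi'D wline.
have mid x y : barW d x = 2^-1 *: (y + c) -> barW d x - c = 2^-1 *: (y - c) :> 'rV[R]_r.
  by move=> ->; apply/rowP => i; rewrite !mxE; field.
have Pu : Pinv (barW d u).
  by split=> //; exists 0; rewrite lexx ler01 subr0 scale1r scale0r addr0 /P -xiE.
have Pw : Pinv (barW d w).
  by split=> //; exists 1; rewrite lexx ler01 subrr scale1r scale0r add0r /P -xi'E.
have cone z : Pinv z -> exists t, [/\ z = plane_pt c a a' t, 0 <= t.1, 0 <= t.2,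
    t.1 = 0 -> z = barW d w & t.2 = 0 -> z = barW d u].
  move=> [Kz [s [/andP[s0 s1] PzE]]]; have [l l0 zl] := proj_ray c_lt W_gt Kz.
  (* Solve [c + l (z - c) = (1 - s) xi + s xi'], where [xi - c] is [k / 2] times [a - c] and
     [xi' - c] is [k' / 2] times [a' - c]. *)
  have zE : z = plane_pt c a a' ((1 - s) * k / 2 / l, s * k' / 2 / l).
    have l_neq0 : l != 0 by rewrite gt_eqF.
    apply: (addIr (- c)); apply: (scalerI l_neq0).
    move: PzE; rewrite /P zl xik xi'k (mid _ _ uE) (mid _ _ wE).
    move=> /(canRL (addKr _)) ->.
    by rewrite /plane_pt /plane_vec /=; apply/rowP => i; rewrite !mxE; field.
  (* With one coordinate zero, [z] is on the line through [c] and [xi] or [xi'], where the type (1B)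
     uniqueness identifies it. *)
  have onray x y kk : 0 < kk -> x = c + kk *: (barW d y - c) -> forall e e' m,
      barW d y = 2^-1 *: (e + c) -> z = c + m *: (e - c) + 0 *: e' -> on_line c x z.
    move=> kk0 -> e e' m yE ->; exists (2 * m / kk); rewrite (mid _ _ yE).
    apply/rowP => i; rewrite !mxE; field; by rewrite gt_eqF.
  exists ((1 - s) * k / 2 / l, s * k' / 2 / l); split=> //=.
  - by rewrite !mulr_ge0 ?invr_ge0 ?(ltW k0) ?(ltW l0) ?subr_ge0.
  - by rewrite !mulr_ge0 ?invr_ge0 ?(ltW k'0) ?(ltW l0).
  - move=> t0; apply/wline; split=> //.
    apply: (onray _ _ _ k'0 xi'k a' 0 (s * k' / 2 / l) wE).
    by rewrite {1}zE /plane_pt /plane_vec /= t0 !scale0r add0r addr0.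
  move=> t0; apply/uline; split=> //.
  apply: (onray _ _ _ k0 xik a 0 ((1 - s) * k / 2 / l) uE).
  by rewrite {1}zE /plane_pt /plane_vec /= t0 !scale0r !addr0.
have par x : conv_seq (map (intvR (R:=R)) [:: p1; p2; p3; p4]) x ->
    Pinv (2^-1 *: (dR d + x)) by move=> /Ppar[].
have [v [s [perm [uswv [caseI noI]]]]] := parallelogram_C d_gt0 A_neq0 F_neq0 C_inH spC
  cC aC a'C cnull anull a'null cext uW wW uE wE Pface Pu Pw cone p1W p2W p3W p4W pE
  pindep par PW.
exists v, s; split=> //; split=> //; split; first by left.
move=> [_ [uI [sI _]]]; case: noI; apply: A_lt0 => //.
have : s \in [:: p1; p2; p3; p4] by rewrite -(perm_mem perm) !inE eqxx !orbT.
by rewrite !inE => /or4P[] /eqP ->.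
Qed.
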